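(* Let $p\in(0,1)$ be constant and let $F$ be a (fixed) bipartite graph with no isolated vertices. Let $\{A_1,B_1\},\ldots,\{A_k,B_k\}$ be the vertex bipartitions of all the connected components of $F$, with $|B_i|\geqslant|A_i|$ for every $i$. Let $a=\max\{|A_1|,\ldots,|A_k|\}$ and let $\delta$ be the minimum degree (in $F$) over all vertices belonging to those sets $A_i$ with $|A_i|=a$. Then, with high probability, $$\mathrm{sat}\big(\mathbb{G}(n,p),F\big)\leqslant\left(\frac{\delta-1}{p^{a-1}}-\frac{\delta-2a+1}{2}+o(1)\right)n.$$
   Context: All graphs are finite, undirected, without loops or multiple edges. For graphs $G$ and $F$, a graph is $F$-free if it has no subgraph (not necessarily induced) isomorphic to $F$. A spanning subgraph $H$ of $G$ is an $F$-saturated subgraph of $G$ if $H$ is $F$-free and adding any edge of $E(G)\setminus E(H)$ to $H$ creates a copy of $F$. $\mathrm{sat}(G,F)$ denotes the minimum number of edges in an $F$-saturated subgraph of $G$. $\mathbb{G}(n,p)$ is the Erdős–Rényi random graph on a fixed vertex set of size $n$, where every two distinct vertices are adjacent independently with probability $p$. ''With high probability'' means with probability tending to $1$ as $n\to\infty$. The term $o(1)$ denotes a function of $n$ (depending on the fixed $p$ and $F$) tending to $0$ as $n\to\infty$. *)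

(* Defs.v *)
From HB Require Import structures.
From mathcomp Require Import all_boot all_order all_algebra.
From mathcomp Require Import all_classical all_reals all_analysis.

Set Implicit Arguments.
Unset Strict Implicit.
Unset Printing Implicit Defensive.

Import Order.TTheory GRing.Theory Num.Theory.
Import numFieldNormedType.Exports.

Local Open Scope nat_scope.

Definition vertex_pairs (V : finType) : {set {set V}} :=
  [set e : {set V} | #|e| == 2].

Record sgraph (V : finType) := SGraph {
  edges : {set {set V}};
  edges_pairs : edges \subset vertex_pairs V }.

HB.instance Definition _ (V : finType) := [isSub for @edges V].
HB.instance Definition _ (V : finType) := [Finite of sgraph V by <:].

Section Graphs.
Variable V : finType.
Implicit Types (G H : sgraph V) (C X Y : {set V}).

(* Irreflexive, since [set x; x] has a single element. *)
Definition adj G : rel V := [rel x y | [set x; y] \in edges G].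

Definition degree G (x : V) : nat := #|[set y | adj G x y]|.

Definition no_isolated G : Prop := forall x, exists y, adj G x y.

Definition independent G X : Prop :=
  forall x y, x \in X -> y \in X -> ~~ adj G x y.

(* X or Y may be empty. *)
Definition bipartition G C X Y : Prop :=
  [/\ X :|: Y = C, [disjoint X & Y], independent G X & independent G Y].

Definition bipartite G : Prop := exists X Y, bipartition G [set: V] X Y.

Definition components G : {set {set V}} :=
  equivalence_partition (connect (adj G)) [set: V].

(* The pairs {A i, B i} list the bipartitions of the components of G, each
   component occurring exactly once. *)
Definition component_bipartitions G (k : nat) (A B : 'I_k -> {set V}) : Prop :=
  [/\ injective (fun i => A i :|: B i),
      [set A i :|: B i | i : 'I_k] = components G
    & forall i, bipartition G (A i :|: B i) (A i) (B i)].

(* Every degree is < #|V|, so the default value is irrelevant unless X is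
   empty. *)
Definition min_degree G X : nat := \big[minn/#|V|]_(x in X) degree G x.

End Graphs.

Section Saturation.
Variables (V W : finType) (F : sgraph W).
Implicit Types (G H : sgraph V).

(* Stated on edge sets so as to apply to H with an edge added. *)
Definition has_copy (E : {set {set V}}) : bool :=
  [exists f : {ffun W -> V},
    injectiveb f && [forall x, forall y, adj F x y ==> ([set f x; f y] \in E)]].

Definition saturated G H : bool :=
  [&& edges H \subset edges G, ~~ has_copy (edges H)
    & [forall e in edges G :\: edges H, has_copy (e |: edges H)]].

(* Since #|edges H| <= #|edges G|, the default value is irrelevant as soon as
   some H is saturated in G, which is always the case when F has an edge. *)
Definition sat G : nat := \big[minn/#|edges G|]_(H | saturated G H) #|edges H|.

End Saturation.

Section RandomGraph.
Local Open Scope ring_scope.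
Local Open Scope classical_set_scope.
Variable R : realType.

Definition Gnp_weight (n : nat) (p : R) (G : sgraph 'I_n) : R :=
  \prod_(e in vertex_pairs 'I_n) (if e \in edges G then p else 1 - p).

Definition Gnp_prob (n : nat) (p : R) (Q : pred (sgraph 'I_n)) : R :=
  \sum_(G : sgraph 'I_n | Q G) Gnp_weight p G.

Definition whp (p : R) (Q : forall n, pred (sgraph 'I_n)) : Prop :=
  (fun n => Gnp_prob p (Q n)) @ \oo --> (1 : R).

End RandomGraph.

(* Main.v *)
(** Fix pairwise disjoint (a - 1)-sets S_1, S_2, ..., S_m of vertices, with m
    growing like a small power of n, and let V_i consist of the remaining
    vertices whose first complete S_i (all its vertices adjacent to the given
    one) is the i-th. With high probability every remaining vertex lies in some
    V_i, and the mean of its index is about 1 / p^(a-1). The graph H0 made of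
    the complete bipartite graphs between S_i and V_i contains no component of
    F with smaller side of size a. Conversely, in ANY F-free graph H containing
    H0, a vertex outside S_i has at most delta - 1 neighbours in V_i: with
    delta neighbours it would complete S_i to a set of a vertices in which to
    embed a smaller side, itself playing the vertex of degree delta. So it
    suffices to complete H0 greedily to a saturated graph and to count: each
    v in V_j has a - 1 neighbours in S_j, at most delta - 1 in each earlier
    V_i, and at most delta - 1 in V_j, these last edges being counted twice.

    When F is disconnected, H0 also receives a constant-size gadget living in
    a clique of G: a clique too small by one vertex to hold all the components
    with smaller side a, and enough copies of K_{a-1,|W|} to host the others.
    After deletion of any vertex, the gadget still hosts all components but
    the one created above. *)
Require Import Defs.
From mathcomp Require Import all_boot all_order all_algebra.
From mathcomp Require Import all_classical all_reals all_analysis.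
From mathcomp Require Import fintype finset zify lra ring.
Import Order.TTheory GRing.Theory Num.Theory.
Import numFieldNormedType.Exports.

Set Implicit Arguments.
Unset Strict Implicit.
Unset Printing Implicit Defensive.

Local Open Scope nat_scope.

(** * Graphs and saturation *)

(** Finding a copy of [F] becomes a count: [tau] gives a role to each vertex of [F], [sigma] to each
    host vertex, and every role needs enough hosts. The i-th vertex of a role goes to the i-th host
    of that role. *)
Lemma fiber_injection (W V : finType) (T : eqType) (tau : W -> T)
    (sigma : V -> T) :
  (forall x, #|[set y | tau y == tau x]| <= #|[set v | sigma v == tau x]|) ->
  exists f : W -> V, injective f /\ forall x, sigma (f x) = tau x.
Proof.
move=> le_fib.
case: (pickP (@predT V)) => [v0 _|V0]; last first.
  have W0 (x : W) : False.
    have := le_fib x; rewrite [X in _ <= X]eq_card0 => [|v].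
      by rewrite leqn0 cards_eq0 => /eqP/setP/(_ x); rewrite !inE eqxx.
    by have := V0 v.
  by exists (fun x => match W0 x with end); split=> x; case: (W0 x).
pose s x := enum [set y | tau y == tau x].
pose t x := enum [set v | sigma v == tau x].
pose f x := nth v0 (t x) (index x (s x)).
have idx x : index x (s x) < size (t x).
  rewrite -cardE; apply: leq_trans (le_fib x).
  by rewrite cardE index_mem mem_enum inE.
have sf x : sigma (f x) = tau x.
  have: f x \in t x by apply: mem_nth.
  by rewrite mem_enum inE => /eqP.
exists f; split=> // x y fxy.
have txy : tau x = tau y by rewrite -!sf fxy.
have sxy : s x = s y by rewrite /s txy.
have ttxy : t x = t y by rewrite /t txy.
move: fxy; rewrite /f ttxy => /eqP; rewrite nth_uniq ?enum_uniq -?ttxy//.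
  rewrite sxy => /eqP idxe.
  rewrite -(@nth_index _ x x (s y)) ?idxe ?nth_index// mem_enum inE ?txy//.
by rewrite ttxy.
Qed.

Section Graphs.
Variable V : finType.
Implicit Types (G H : sgraph V).

Lemma adj_sym G x y : adj G x y = adj G y x.
Proof. by rewrite /adj /= setUC. Qed.

Lemma adj_neq G x y : adj G x y -> x != y.
Proof.
rewrite /adj /= => /(subsetP (edges_pairs G)); rewrite inE.
by rewrite cards2; case: (x != y).
Qed.

Lemma edge_adj G e : e \in edges G -> exists x y, e = [set x; y] /\ adj G x y.
Proof.
move=> eG; have := subsetP (edges_pairs G) _ eG.
rewrite inE => /cards2P [x [y [xy ee]]].
by exists x, y; split=> //; rewrite /adj /= -ee.
Qed.

Lemma handshake_le G :
  2 * #|edges G| <= \sum_x \sum_y (adj G x y : nat).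
Proof.
have -> : 2 * #|edges G| = \sum_(e in edges G) \sum_(x : V) (x \in e : nat).
  rewrite mulnC -sum_nat_const; apply: eq_bigr => e eG.
  rewrite -big_mkcond sum1_card.
  by have := subsetP (edges_pairs G) _ eG; rewrite inE => /eqP.
rewrite exchange_big; apply: leq_sum => x _.
rewrite -[leqLHS]big_mkcondr -[leqRHS]big_mkcond !sum1_card.
apply: leq_trans (leq_imset_card (fun y => [set x; y]) _).
apply/subset_leq_card/subsetP => e; rewrite unfold_in => /andP[eG xe].
have [y [z [ee yz]]] := edge_adj eG.
move: xe; rewrite ee !inE => /orP[]/eqP xe; subst x.
  by apply/imsetP; exists z; rewrite ?unfold_in.
have zy : adj G z y by rewrite adj_sym.
by rewrite setUC; apply/imsetP; exists y.
Qed.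

(** Intersecting with [vertex_pairs] discards loops, so that any relation defines a graph. *)
Definition graph_of (h : rel V) : sgraph V :=
  SGraph (subsetIr [set [set u.1;
    u.2] | u : V * V & h u.1 u.2] (vertex_pairs V)).

Lemma mem_graph_of (h : rel V) x y : symmetric h -> irreflexive h ->
  adj (graph_of h) x y = h x y.
Proof.
move=> hsym hirr; apply/idP/idP => [|hxy]; rewrite /adj /= !inE.
  case/andP=> /imsetP[[u v]]; rewrite !inE /= => huv /setP exy.
  rewrite cards2 => xNy.
  have xNy' : x != y by case: (x != y) xNy.
  have := exy x; have := exy y; rewrite !inE !eqxx orbT /=.
  case/esym/orP=> /eqP ye /esym/orP[]/eqP xe; subst x y => //.
  - by rewrite eqxx in xNy'.
  - by rewrite hsym.
  - by rewrite eqxx in xNy'.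
apply/andP; split; first by apply/imsetP; exists (x, y); rewrite // inE.
rewrite cards2; suff -> : x != y by [].
by apply: contraTneq hxy => ->; rewrite hirr.
Qed.

End Graphs.

Section Saturation.
Variables (V W : finType) (F : sgraph W).
Implicit Types (G H : sgraph V).

Lemma sat_le G H : saturated F G H -> sat F G <= #|edges H|.
Proof.
move=> sH; rewrite /sat; have := mem_index_enum H.
elim: (index_enum _) => // H' r IHr; rewrite inE big_cons.
case/orP=> [/eqP<-|/IHr le_r]; first by rewrite sH geq_minl.
by case: ifP => // _; rewrite geq_min le_r orbT.
Qed.

Lemma has_copyP (E : {set {set V}}) :
  reflect (exists f : W -> V, injective f /\
             forall x y, adj F x y -> [set f x; f y] \in E)
          (has_copy F E).
Proof.
apply: (iffP existsP) =>
  [[f /andP[/injectiveP injf /forallP fE]]|[f [injf fE]]].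
  exists f; split=> // x y xy; have /forallP/(_ y) := fE x.
  by rewrite xy.
exists (finfun f); apply/andP; split.
  by apply/injectiveP => x y; rewrite !ffunE; apply: injf.
by apply/forallP => x; apply/forallP => y; apply/implyP => xy;
  rewrite !ffunE fE.
Qed.

(** An [F]-free graph between [H0] and [G] with the most edges is saturated: a further edge of [G]
    creating no copy would contradict maximality. *)
Lemma saturated_extension G H0 :
  edges H0 \subset edges G -> ~~ has_copy F (edges H0) ->
  exists H, edges H0 \subset edges H /\ saturated F G H.
Proof.
move=> sub0 free0.
pose P H := [&& edges H0 \subset edges H, edges H \subset edges G
             & ~~ has_copy F (edges H)].
have PH0 : P H0 by rewrite /P subxx sub0 free0.
case: (@arg_maxnP _ H0 P (fun H => #|edges H|) PH0) => H /and3P[H0H HG Hfree]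
  Hmax.
exists H; split=> //; rewrite /saturated HG Hfree /=.
apply/forallP => e; apply/implyP; rewrite inE => /andP[eNH eG].
apply: contraT => noc.
have pe : e |: edges H \subset vertex_pairs V.
  by rewrite subUset sub1set edges_pairs (subsetP (edges_pairs G)).
have := Hmax (SGraph pe); rewrite /P /= noc andbT.
rewrite (subset_trans H0H (subsetUr _ _)) subUset sub1set eG HG /=.
by move=> /(_ isT); rewrite cardsU1 eNH add1n ltnn.
Qed.

End Saturation.

Lemma min_degree_attained (V : finType) (G : sgraph V) (X : {set V}) x :
  x \in X -> exists2 y, y \in X & degree G y = min_degree G X.
Proof.
move=> xX.
(* This bound makes the default value [#|V|] of the big minimum harmless. *)
have deg_le y : degree G y <= #|V| by apply: max_card.
have : forall r, has [in X] r ->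
   exists2 y, y \in X & degree G y = \big[minn/#|V|]_(x <- r | x \in X) degree
     G x.
  elim=> // z r IHr /=; rewrite big_cons; case: ifP => zX /=; last exact: IHr.
  move=> _; case: (boolP (has [in X] r)) => [/IHr[y yX <-]|noX].
    rewrite /minn; case: ifP => _; [by exists z | by exists y].
  rewrite big_hasC //; exists z => //.
  by apply/esym/minn_idPl.
by apply; apply/hasP; exists x; rewrite ?mem_index_enum.
Qed.

(** Ordered adjacent pairs are counted. Inside [D], a pair on different levels is charged to its
    higher end, which has at most [d] neighbours on each lower level. *)
Lemma edge_count (V : finType) (H : sgraph V) (m a1 d : nat) (D : {set V})
    (lv : V -> 'I_m) (S : 'I_m -> {set V}) :
  (forall j v, v \in D -> v \notin S j) ->
  (forall j, #|S j| <= a1) ->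
  (forall v j, v \notin S j ->
     #|[set u in D | (lv u == j) && adj H v u]| <= d) ->
  2 * #|edges H| <= d * #|V| + 2 * (d * \sum_(v in D) lv v) + 2 * (a1 * #|V|)
                    + 2 * (#|~: D| * (m * d)) + #|~: D| ^ 2.
Proof.
move=> DS Sle degle; apply: leq_trans (handshake_le H) _.
have Nle v j : v \notin S j -> \sum_(u in D | lv u == j) adj H v u <= d.
  move=> vNS; apply: leq_trans (degle v j vNS).
  rewrite -sum1_card [leqRHS]big_mkcond [leqLHS]big_mkcond leq_sum // => u _.
  by rewrite !inE; case: (u \in D); case: (lv u == j); case: (adj H v u).
have split_sum (f : V -> nat) :
    \sum_x f x = \sum_(x in D) f x + \sum_(x in ~: D) f x.
  by rewrite (bigID (mem D)) /=; congr addn; apply: eq_bigl => x; rewrite inE.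
pose XD := \sum_(x in ~: D) \sum_(y in D) adj H x y.
pose XX := \sum_(x in ~: D) \sum_(y in ~: D) adj H x y.
pose T := \sum_(x in D) \sum_(y in D) (adj H x y && (lv y < lv x)).
pose E := \sum_(x in D) \sum_(y in D) (adj H x y && (lv y == lv x)).
(* [T] enters twice because swapping the ends turns descending pairs into ascending ones; [E]
   already contains both orders of each pair. *)
have -> : \sum_x \sum_y adj H x y = (T + E + T) + XD + (XD + XX).
  rewrite split_sum; congr (_ + _); last first.
    by rewrite /XD /XX -big_split; apply: eq_bigr => x _; rewrite split_sum.
  under eq_bigr => x _ do rewrite split_sum; rewrite big_split /=;
    congr (_ + _).
    have {2}-> : T = \sum_(x in D) \sum_(y in D) (adj H x y && (lv x < lv y)).
      rewrite /T exchange_big /=; apply: eq_bigr => x _; apply: eq_bigr => y _.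
      by rewrite adj_sym.
    rewrite /E /T -!big_split /=; apply: eq_bigr => x _.
    rewrite -!big_split /=; apply: eq_bigr => y _.
    by rewrite -(inj_eq val_inj) /=; case: (adj H x y) => //=; case: ltngtP.
  rewrite /XD exchange_big /=; apply: eq_bigr => x _; apply: eq_bigr => y _.
  by rewrite adj_sym.
have T_le : T <= d * \sum_(v in D) lv v.
  rewrite /T big_distrr /=; apply: leq_sum => x xD.
  have -> : \sum_(y in D) (adj H x y && (lv y < lv x) : nat) =
            \sum_(j < m | j < lv x) \sum_(y in D | lv y == j) adj H x y.
    rewrite (eq_bigr (fun y => if lv y < lv x then (adj H x y : nat) else 0)).
      rewrite -big_mkcondr (partition_big lv (fun j => j < lv x)) => [|y
        /andP[]//].
      apply: eq_bigr => j jx; apply: eq_bigl => y.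
      by case: eqP => [->|]; rewrite ?jx ?andbT ?andbF.
    by move=> y _; rewrite andbC; case: ifP.
  apply: (@leq_trans (\sum_(j < m | j < lv x) d)).
    by apply: leq_sum => j _; apply: Nle; apply: DS.
  rewrite -(big_ord_widen _ (fun=> d)) ?sum_nat_const ?card_ord ?[d * _]mulnC
    //.
  exact/ltnW.
have E_le : E <= d * #|V|.
  apply: (@leq_trans (\sum_(x in D) d)).
    apply: leq_sum => x xD; apply: leq_trans (Nle x (lv x) (DS _ _ xD)).
    rewrite [leqRHS]big_mkcondr; apply: leq_sum => y _.
    by case: (adj _ _ _); case: eqP.
  by rewrite sum_nat_const mulnC leq_mul2l max_card orbT.
have XX_le : XX <= #|~: D| ^ 2.
  rewrite -mulnn -sum_nat_const; apply: leq_sum => x _.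
  by rewrite -sum1_card; apply: leq_sum => y _; case: (adj _ _ _).
(* A vertex [x] outside [D] adjacent to [y] in [D] either lies in the set [S] of the level of [y],
   at most [a1] times for each [y], or is covered by the degree hypothesis, level by level. *)
have XD_le : XD <= a1 * #|V| + #|~: D| * (m * d).
  apply: (@leq_trans (\sum_(x in ~: D) \sum_(y in D)
      ((x \in S (lv y)) + ((x \notin S (lv y)) && adj H x y)))).
    apply: leq_sum => x _; apply: leq_sum => y _.
    by case: (x \in S _); case: (adj _ _ _).
  under eq_bigr do rewrite big_split /=.
  rewrite big_split /=; apply: leq_add.
    rewrite exchange_big /=; apply: (@leq_trans (\sum_(y in D) a1)).
      apply: leq_sum => y _; apply: leq_trans (Sle (lv y)).
      rewrite -sum1_card [leqLHS]big_mkcond [leqRHS]big_mkcond;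
        apply: leq_sum => x _.
      by case: ifP => // _; case: (x \in S _).
    by rewrite sum_nat_const mulnC leq_mul2l max_card orbT.
  rewrite -sum_nat_const; apply: leq_sum => x _.
  rewrite (partition_big lv predT) //=.
  rewrite -[m in leqRHS]card_ord -sum_nat_const; apply: leq_sum => j _.
  case: (boolP (x \in S j)) => [xS|/Nle]; last first.
    apply: leq_trans; apply: leq_sum => y _.
    by case: (x \in S _).
  by rewrite big1 // => y /andP[_ /eqP->]; rewrite xS.
move: T_le E_le XX_le XD_le; move: (d * \sum_(_ in D) _) => t; lia.
Qed.

Lemma card_bigcup_le (I T : finType) (P : pred I) (X : I -> {set T}) :
  #|\bigcup_(i | P i) X i| <= \sum_(i | P i) #|X i|.
Proof.
elim/big_rec2: _ => [|i n Y _ le_n]; first by rewrite cards0.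
by apply: leq_trans (leq_add (leqnn _) le_n); rewrite cardsU leq_subr.
Qed.

(** * Product measures and first hitting indices *)

Section ProductMeasure.
Local Open Scope ring_scope.
Variables (R : realFieldType) (T : finType) (pi : T -> R).
Implicit Types (X Y A : {set T}) (f g : {set T} -> R).

(** The law of a random subset of [T] containing each [e] independently with probability [pi e]. *)
Definition mass X : R := \prod_e (if e \in X then pi e else 1 - pi e).
Definition expect f : R := \sum_X mass X * f X.
(** Dependence on the trace on [A] only, which stands for measurability in the independence
    arguments. *)
Definition local A f := forall X Y, {in A, X =i Y} -> f X = f Y.

Lemma eq_expect f g : f =1 g -> expect f = expect g.
Proof. by move=> fg; apply: eq_bigr => X _; rewrite fg. Qed.

(** Mass times indicator is a product over [T], so the sum over all sets expands a product of
    two-term sums, equal to 1 outside [A]. *)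
Lemma expect_subset A :
  expect (fun X => (A \subset X)%:R) = \prod_(e in A) pi e.
Proof.
transitivity (\sum_(X : {set T}) \prod_(e : T)
    (if e \in X then pi e else (1 - pi e) * (e \notin A)%:R)).
  apply: eq_bigr => X _; rewrite /mass.
  have -> : (A \subset X)%:R =
            \prod_(e : T) (if e \in X then 1 else (e \notin A)%:R) :> R.
    case: (boolP (A \subset X)) => [/subsetP AX|/subsetPn[e eA eX]].
      rewrite big1 // => e _; case: ifP => // eNX.
      by rewrite (contraFN (AX e) eNX).
    by rewrite (bigD1 e) //= (negbTE eX) eA mul0r.
  by rewrite -big_split; apply: eq_bigr => e _ /=; case: ifP; rewrite ?mulr1.
transitivity (\prod_e (pi e + (1 - pi e) * (e \notin A)%:R)).
  by rewrite bigA_distr; apply: eq_bigl => X; rewrite inE.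
rewrite [RHS]big_mkcond; apply: eq_bigr => e _ /=.
by case: (e \in A); rewrite ?mulr0 ?addr0 // mulr1 addrC subrK.
Qed.

Lemma expect1 : expect (fun=> 1) = 1.
Proof.
transitivity (expect (fun X => (set0 \subset X)%:R)).
  by apply: eq_expect => X; rewrite sub0set.
by rewrite expect_subset big_set0.
Qed.

Lemma expectZ x f : expect (fun X => x * f X) = x * expect f.
Proof. by rewrite big_distrr; apply: eq_bigr => X _; rewrite mulrCA. Qed.

Lemma expectD f g : expect (fun X => f X + g X) = expect f + expect g.
Proof. by rewrite -big_split; apply: eq_bigr => X _; rewrite mulrDr. Qed.

Lemma expect_sum (I : finType) (P : pred I) (F : I -> {set T} -> R) :
  expect (fun X => \sum_(i | P i) F i X) = \sum_(i | P i) expect (F i).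
Proof.
rewrite exchange_big; apply: eq_bigr => X _; exact: big_distrr.
Qed.

Hypothesis pi01 : forall e, 0 <= pi e <= 1.

Lemma mass_ge0 X : 0 <= mass X.
Proof.
apply: prodr_ge0 => e _; have /andP[? ?] := pi01 e.
by case: ifP; rewrite ?subr_ge0.
Qed.

Lemma le_expect f g : (forall X, f X <= g X) -> expect f <= expect g.
Proof. by move=> fg; apply: ler_sum => X _; rewrite ler_wpM2l ?mass_ge0. Qed.

(* Exchanging the traces on A of two independent copies preserves the product
   measure. *)
Lemma expect_indep A f g : local A f -> local (~: A) g ->
  expect (fun X => f X * g X) = expect f * expect g.
Proof.
move=> fA gA; pose mix X Y := (X :&: A) :|: (Y :\: A).
pose h (u : {set T} * {set T}) := (mix u.1 u.2, mix u.2 u.1).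
have hK : involutive h.
  move=> [X Y]; rewrite /h /mix /=; congr (_, _); apply/setP => e;
  by rewrite !inE; case: (e \in A); rewrite ?andbT ?andbF ?orbF.
rewrite -[LHS]mulr1 -expect1 /expect !big_distrlr /= !pair_bigA /=.
rewrite (reindex_inj (inv_inj hK)) /=; apply: eq_bigr => -[X Y] _ /=.
rewrite mulr1 -!mulrA.
have -> : f (mix X Y) = f X.
  by apply: fA => e eA; rewrite !inE eA andbT orbF.
have -> : g (mix X Y) = g Y.
  by apply: gA => e; rewrite !inE => /negbTE->; rewrite andbF.
have mXY : mass (mix X Y) * mass (mix Y X) = mass X * mass Y.
  rewrite -!big_split; apply: eq_bigr => e _ /=; rewrite !inE.
  by case: (e \in A); rewrite ?andbT ?andbF ?orbF //= mulrC.
transitivity (mass (mix X Y) * mass (mix Y X) * (f X * g Y)); first by ring.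
by rewrite mXY; ring.
Qed.

Lemma expect_prod (I : eqType) (r : seq I) (A : I -> {set T})
    (F : I -> {set T} -> R) : uniq r ->
  {in r, forall i, local (A i) (F i)} ->
  {in r &, forall i j, i != j -> [disjoint A i & A j]} ->
  expect (fun X => \prod_(i <- r) F i X) = \prod_(i <- r) expect (F i).
Proof.
elim: r => [|i r IHr] /=.
  by move=> _ _ _; rewrite big_nil -[RHS]expect1; apply: eq_expect => X;
    rewrite big_nil.
move=> /andP[iNr ur] FA disjA; rewrite big_cons -IHr //; first last.
- by move=> j l jr lr; apply: disjA; rewrite inE ?jr ?lr orbT.
- by move=> j jr; apply: FA; rewrite inE jr orbT.
rewrite -(@expect_indep (A i)).
- by apply: eq_expect => X; rewrite big_cons.
- by apply: FA; rewrite inE eqxx.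
- move=> X Y XY; rewrite big_seq [RHS]big_seq; apply: eq_bigr => j jr.
  apply: (FA j); first by rewrite inE jr orbT.
  move=> e eA; apply: XY; rewrite inE.
  have ij : i != j by apply: contraNneq iNr => ->.
  by rewrite (disjointFl (disjA i j _ _ ij)) ?inE ?eqxx ?jr ?orbT.
Qed.

End ProductMeasure.

Section FirstHit.
Local Open Scope ring_scope.
Variables (R : realFieldType) (T : finType) (pi : T -> R).
Hypothesis pi01 : forall e, 0 <= pi e <= 1.
Variables (m : nat) (I : finType) (U : {set I}) (A : I -> 'I_m -> {set T}).
Variable q : R.
Hypothesis q01 : 0 < q <= 1.
Hypothesis disjA : {in U &, forall u v i j, (u, i) != (v, j) ->
  [disjoint A u i & A v j]}.
Hypothesis probA : {in U, forall v i, \prod_(e in A v i) pi e = q}.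
Notation E := (expect pi).

Definition missed v i (X : {set T}) : R := (~~ (A v i \subset X))%:R.

(* The least i with A v i contained in X (m if there is none), written as the
   number of j such that X contains none of A v 0, ..., A v j. *)
Definition first_hit v (X : {set T}) : R :=
  \sum_(j < m) \prod_(i < m | (i <= j)%N) missed v i X.
(** Tail-sum formula for a truncated geometric variable: term [j] is the probability that the first
    j + 1 sets are all missed. *)
Definition first_hit_mean : R := \sum_(j < m) (1 - q) ^+ j.+1.
Notation mu := first_hit_mean.

Lemma subset_local (B : {set T}) (f : bool -> R) :
  local B (fun X : {set T} => f (B \subset X)).
Proof.
move=> X Y XY; congr f; apply/subsetP/subsetP => BX e eB;
  first by rewrite -XY ?BX.
by rewrite XY ?BX.
Qed.

Lemma expect_not_subset (B : {set T}) :
  E (fun X => (~~ (B \subset X))%:R) = 1 - \prod_(e in B) pi e.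
Proof.
rewrite -expect_subset -[X in X - _](expect1 pi) -[X in _ - X]mul1r -mulNr
  -expectZ.
rewrite -expectD; apply: eq_expect => X.
by case: (_ \subset _); rewrite /= mulN1r ?subrr ?subr0.
Qed.

Lemma missed01 v i X : 0 <= missed v i X <= 1.
Proof. by rewrite /missed; case: (_ \subset _); rewrite ?lexx ?ler01. Qed.

Lemma expect_missed v (P : pred 'I_m) : v \in U ->
  E (fun X => \prod_(i | P i) missed v i X) = (1 - q) ^+ #|P|.
Proof.
move=> vU; pose r := [seq i <- enum 'I_m | P i].
have rE (f : 'I_m -> R) : \prod_(i | P i) f i = \prod_(i <- r) f i.
  by rewrite big_filter big_enum_cond.
transitivity (E (fun X => \prod_(i <- r) missed v i X)).
  by apply: eq_expect => X; rewrite rE.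
rewrite (@expect_prod _ _ _ _ r (A v)).
- rewrite -rE -prodr_const; apply: eq_bigr => i _.
  by rewrite expect_not_subset probA.
- by rewrite filter_uniq ?enum_uniq.
- by move=> i _; apply: (subset_local (fun b => (~~ b)%:R)).
- move=> i j _ _ ij; apply: disjA => //.
  by apply: contraNneq ij => -[->].
Qed.

Lemma expect_first_hit v : v \in U -> E (first_hit v) = mu.
Proof.
move=> vU; rewrite /first_hit expect_sum; apply: eq_bigr => j _.
rewrite expect_missed //; congr (_ ^+ _).
rewrite -sum1_card; transitivity (\sum_(i < m | (i < j.+1)%N) 1)%N.
  by apply: eq_bigl => i; rewrite unfold_in ltnS.
by rewrite -(big_ord_widen m (fun=> 1%N)) // sum1_card card_ord.
Qed.

Lemma first_hit_itv v X : 0 <= first_hit v X <= m%:R.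
Proof.
apply/andP; split.
  apply: sumr_ge0 => j _; apply: prodr_ge0 => i _.
  by case/andP: (missed01 v i X).
rewrite -[m in leRHS]card_ord -sumr_const; apply: ler_sum => j _.
by apply: Num.Theory.prodr_ile1 => i _; apply: missed01.
Qed.

Lemma first_hit_ge v (X : {set T}) (l : nat) :
  (l <= m)%N -> (forall i : 'I_m, (i < l)%N -> ~~ (A v i \subset X)) ->
  l%:R <= first_hit v X.
Proof.
move=> lm missl; rewrite /first_hit (bigID (fun j : 'I_m => (j < l)%N)) /=.
rewrite -[leLHS]addr0 lerD //; last first.
  apply: sumr_ge0 => j _; apply: prodr_ge0 => i _.
  by case/andP: (missed01 v i X).
rewrite -[l in leLHS]card_ord -sumr_const (big_ord_widen m (fun=> 1)) //.
apply: ler_sum => j jl; rewrite big1 // => i ij.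
by rewrite /missed missl // (leq_ltn_trans ij).
Qed.

Lemma first_hit_mean_itv : 0 <= mu <= m%:R.
Proof.
have [q0 q1] := andP q01.
have x0 : 0 <= 1 - q by rewrite subr_ge0.
apply/andP; split; first by apply: sumr_ge0 => j _; rewrite exprn_ge0.
rewrite -[m in leRHS]card_ord -sumr_const; apply: ler_sum => j _.
by rewrite exprn_ile1 // gerBl ltW.
Qed.

(** Covariances of distinct vertices vanish because their sets are disjoint; a diagonal term is at
    most m^2 since the variable and its mean both lie between 0 and m. *)
Lemma first_hit_variance_le :
  E (fun X => (\sum_(v in U) (first_hit v X - mu)) ^+ 2)
    <= #|U|%:R * m%:R ^+ 2.
Proof.
have -> : E (fun X => (\sum_(v in U) (first_hit v X - mu)) ^+ 2) =
    \sum_(u in U) \sum_(v in U)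
       E (fun X => (first_hit u X - mu) * (first_hit v X - mu)).
  under [RHS]eq_bigr do rewrite -expect_sum.
  rewrite -expect_sum; apply: eq_expect => X.
  by rewrite expr2 big_distrlr.
have le_diag u : u \in U ->
    \sum_(v in U) E (fun X => (first_hit u X - mu) * (first_hit v X - mu))
      <= m%:R ^+ 2.
  move=> uU; rewrite (bigD1 u) //= big1 ?addr0.
    rewrite -[leRHS]mulr1 -[X in _ <= _ * X](expect1 pi) -expectZ;
      apply: le_expect => // X.
    have norm_le : `|first_hit u X - mu| <= m%:R.
      have := first_hit_itv u X; have := first_hit_mean_itv.
      by rewrite ler_norml; lra.
    by rewrite mulr1 -expr2 -real_normK ?num_real // lerXn2r ?nnegrE.
  move=> v /andP[vU vu]; have disj_uv i j : [disjoint A u i & A v j].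
    by apply: disjA => //; apply: contraNneq vu => -[->].
  have mean0 w : w \in U -> E (fun X => first_hit w X - mu) = 0.
    move=> wU; transitivity (E (first_hit w) + (- mu) * E (fun=> 1)).
      by rewrite -expectZ -expectD; apply: eq_expect => X; rewrite mulr1.
    by rewrite expect_first_hit // expect1 mulr1 subrr.
  have first_hit_local w (B : {set T}) : (forall i, A w i \subset B) ->
      local B (fun X => first_hit w X - mu).
    move=> AB X Y XY; congr (_ - _); apply: eq_bigr => j _;
      apply: eq_bigr => i _.
    apply: (subset_local (fun b => (~~ b)%:R)) => e eA; apply: XY.
    exact: (subsetP (AB i)).
  rewrite (@expect_indep _ _ _ (\bigcup_i A u i)) ?mean0 ?mul0r //.
    by apply: first_hit_local => i; apply: (bigcup_sup i).
  apply: first_hit_local => i; rewrite -disjoints_subset disjoint_sym.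
  rewrite disjoint_sym; apply: bigcup_disjoint => j _; rewrite disjoint_sym.
  exact: disj_uv.
apply: le_trans (ler_sum _ le_diag) _.
by rewrite sumr_const -[leLHS]mulr_natl.
Qed.

Variables (Z : 'I_m -> {set T}) (r t : R).
Hypothesis t_gt0 : 0 < t.
Hypothesis disjZ : forall i j, i != j -> [disjoint Z i & Z j].
Hypothesis probZ : forall i, \prod_(e in Z i) pi e = r.

(** Each of the three non-negative terms is at least 1 on one kind of failure: no [Z b] is present,
    some vertex misses all its sets, or the sum of indices deviates from its mean by at least [t]. A
    value below 1 excludes them all, so one expectation merges the union bound with Chebyshev's
    inequality. *)
Definition badness (X : {set T}) : R :=
  \prod_(b < m) (~~ (Z b \subset X))%:R
  + \sum_(v in U) \prod_(i < m) missed v i X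
  + (\sum_(v in U) (first_hit v X - mu)) ^+ 2 / t ^+ 2.

Lemma badness_lt1 X : badness X < 1 ->
  [/\ exists b, Z b \subset X,
      forall v, v \in U -> exists i, A v i \subset X
    & \sum_(v in U) first_hit v X <= #|U|%:R * mu + t].
Proof.
have Z_ge0 : 0 <= \prod_(b < m) (~~ (Z b \subset X))%:R :> R.
  by apply: prodr_ge0 => b _.
have hit_ge0 v : 0 <= \prod_(i < m) missed v i X :> R.
  by apply: prodr_ge0 => i _; case/andP: (missed01 v i X).
have sum_hit_ge0 : 0 <= \sum_(v in U) \prod_(i < m) missed v i X.
  exact: sumr_ge0.
have var_ge0 : 0 <= (\sum_(v in U) (first_hit v X - mu)) ^+ 2 / t ^+ 2.
  by rewrite divr_ge0 ?sqr_ge0.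
rewrite /badness => bad; split.
- apply/existsP; apply: contraTT bad => /existsPn noZ.
  rewrite -leNgt big1 => [|b _]; first by lra.
  by rewrite noZ.
- move=> v vU; apply/existsP; apply: contraTT bad => /existsPn noA.
  rewrite (bigD1 v vU) /= [\prod_(i < m) missed v i X]big1 => [|i _];
    last first.
    by rewrite /missed noA.
  have : 0 <= \sum_(i in U | i != v) \prod_(j < m) missed i j X by exact:
    sumr_ge0.
  by rewrite -leNgt; lra.
- have : (\sum_(v in U) (first_hit v X - mu)) ^+ 2 < t ^+ 2.
    rewrite -[ltRHS]mul1r -ltr_pdivrMr ?exprn_gt0 //; lra.
  rewrite sumrB sumr_const -[X in _ - X]mulr_natl => lt_t; rewrite leNgt;
    apply/negP => gt_t.
  have t0 := t_gt0; set x := _ - _ in lt_t.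
  have tx : t <= x by rewrite /x; lra.
  by move: lt_t; rewrite ltNge lerXn2r ?nnegrE ?(le_trans (ltW t0)) ?(ltW t0).
Qed.

Lemma expect_badness_le :
  E badness <= (1 - r) ^+ m + #|U|%:R * (1 - q) ^+ m
               + #|U|%:R * m%:R ^+ 2 / t ^+ 2.
Proof.
rewrite /badness !expectD; apply: lerD; first apply: lerD.
- rewrite (_ : E _ = E (fun X => \prod_(b <- enum 'I_m) (~~ (Z b \subset
  X))%:R)).
    rewrite (@expect_prod _ _ _ _ _ Z) ?enum_uniq //.
    - rewrite big_enum /= -[m in leRHS]card_ord -prodr_const.
      by under eq_bigr do rewrite expect_not_subset probZ.
    - by move=> i _; apply: (subset_local (fun b => (~~ b)%:R)).
    - by move=> i j _ _; apply: disjZ.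
  by apply: eq_expect => X; rewrite big_enum.
- rewrite expect_sum [leRHS]mulr_natl -sumr_const; apply: ler_sum => v vU.
  by rewrite expect_missed // card_ord.
- rewrite (_ : E _ = (t ^+ 2)^-1 * E (fun X => (\sum_(v in U) (first_hit v X -
  mu)) ^+ 2)).
    rewrite [leRHS]mulrC ler_wpM2l ?first_hit_variance_le //.
    by rewrite invr_ge0 exprn_ge0 // ltW.
  by rewrite -expectZ; apply: eq_expect => X; rewrite mulrC.
Qed.

End FirstHit.

(** * The random graph as a product measure *)

Section Gnp.
Local Open Scope ring_scope.
Variables (R : realType) (p : R) (n : nat).
Hypothesis p01 : 0 < p < 1.

(* Probability 0 outside the pairs lets the product measure live on all sets of
   sets of vertices. *)
Definition edge_prob (e : {set 'I_n}) : R := if e \in vertex_pairs 'I_n then p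
  else 0.

Lemma edge_prob01 e : 0 <= edge_prob e <= 1.
Proof. by rewrite /edge_prob; case: ifP; rewrite ?lexx ?ler01 //;
  case/andP: p01 => /ltW-> /ltW->. Qed.

Lemma Gnp_weight_ge0 (G : sgraph 'I_n) : 0 <= Gnp_weight p G.
Proof. by apply: prodr_ge0 => e _; case: ifP => _; case/andP: p01; lra. Qed.

(** A set containing a non-pair has mass 0, and the other sets are exactly the edge sets of
    graphs. *)
Lemma Gnp_expect (f : {set {set 'I_n}} -> R) :
  \sum_(G : sgraph 'I_n) Gnp_weight p G * f (edges G) = expect edge_prob f.
Proof.
rewrite /expect [RHS](bigID (fun X : {set {set 'I_n}} => X \subset vertex_pairs
  'I_n)) /= [X in _ = _ + X]big1 ?addr0.
  pose G0 : sgraph 'I_n := SGraph (sub0set _).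
  rewrite (reindex (@edges 'I_n)) /=; last first.
    exists (insubd G0) => [G _|X]; first exact: valKd.
    by rewrite inE => XP; apply: insubdK.
  apply: eq_big => [G|G _]; first by rewrite edges_pairs.
  congr (_ * _); rewrite /Gnp_weight /mass [LHS]big_mkcond;
    apply: eq_bigr => e _.
  rewrite /edge_prob; case: ifP => // eP; case: ifP => [eG|];
    last by rewrite subr0.
  by rewrite (subsetP (edges_pairs G)) in eP.
move=> X /subsetPn[e eX eP]; rewrite /mass (bigD1 e) //= eX.
by rewrite /edge_prob (negbTE eP) !mul0r.
Qed.

Lemma Gnp_prob_le1 (Q : pred (sgraph 'I_n)) : Gnp_prob p Q <= 1.
Proof.
rewrite -(expect1 edge_prob) -Gnp_expect /Gnp_prob [leLHS]big_mkcond.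
apply: ler_sum => G _; rewrite mulr1; case: ifP => // _; exact: Gnp_weight_ge0.
Qed.

(** Markov's inequality at the value 1. *)
Lemma Gnp_prob_ge (Q : pred (sgraph 'I_n)) (f : {set {set 'I_n}} -> R) :
  (forall G, 0 <= f (edges G)) -> (forall G, f (edges G) < 1 -> Q G) ->
  1 - expect edge_prob f <= Gnp_prob p Q.
Proof.
move=> f0 fQ; rewrite -[X in X - _](expect1 edge_prob) -!Gnp_expect -sumrB.
rewrite /Gnp_prob [leRHS]big_mkcond; apply: ler_sum => G _.
rewrite -mulrBr; have w0 := Gnp_weight_ge0 G.
case: ifP => [_|/negbT]; first by rewrite ler_piMr // gerBl.
by move/(contraNN (fQ G)); rewrite -leNgt => f1;
  rewrite mulr_ge0_le0 // subr_le0.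
Qed.

End Gnp.

(** * Asymptotic estimates *)

Section Asymptotics.
Local Open Scope classical_set_scope.
Local Open Scope ring_scope.

Lemma geometric_sum_le (R : realFieldType) (x : R) (m : nat) :
  0 <= x < 1 -> \sum_(j < m) x ^+ j.+1 <= (1 - x)^-1 - 1.
Proof.
move=> /andP[x0 x1]; have y0 : 0 < 1 - x by rewrite subr_gt0.
have -> : (1 - x)^-1 - 1 = x / (1 - x) by field; rewrite gt_eqF.
rewrite ler_pdivlMr //.
suff -> : (\sum_(j < m) x ^+ j.+1) * (1 - x) = x - x ^+ m.+1.
  by rewrite gerBl exprn_ge0.
elim: m => [|m IHm]; first by rewrite big_ord0 mul0r expr1 subrr.
by rewrite big_ord_recr /= mulrDl IHm [in RHS]exprS; ring.
Qed.

(** From 1 - x <= exp(-x) and exp(y) >= y at y = x m / 6. The sixth power beats a factor n < (m +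
    1)^5 and leaves a bound of order 1 / m. *)
Lemma one_subX_le (R : realType) (x : R) (m : nat) : 0 < x <= 1 -> (0 < m)%N ->
  (1 - x) ^+ m <= (6 / x) ^+ 6 / m%:R ^+ 6.
Proof.
move=> /andP[x0 x1] m0; have mR : 0 < m%:R :> R by rewrite ltr0n.
have y0 : 0 < x * m%:R / 6 by rewrite divr_gt0 ?mulr_gt0.
apply: (@le_trans _ _ (expR (- x) ^+ m)).
  rewrite lerXn2r ?nnegrE ?subr_ge0 ?expR_ge0 //.
  exact: (le_trans _ (expR_ge1Dx (- x))).
have -> : expR (- x) ^+ m = (expR (x * m%:R / 6) ^+ 6)^-1.
  by rewrite -!expRM_natl -expRN; congr expR; rewrite mulrN; congr (- _); field.
have -> : (6 / x) ^+ 6 / m%:R ^+ 6 = ((x * m%:R / 6) ^+ 6)^-1.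
  by field; rewrite !gt_eqF.
rewrite lef_pV2 ?posrE ?exprn_gt0 ?expR_gt0 // lerXn2r ?nnegrE ?expR_ge0 ?ltW
  //.
apply: lt_le_trans (expR_ge1Dx _); lra.
Qed.

(* With m = fifth_root n levels, n / m is a negligible deviation while
   Chebyshev's bound n m^2 / (n / m)^2 = m^4 / n still tends to 0. *)
Definition fifth_root (n : nat) : nat := (\max_(i < n.+1 | i ^ 5 <= n) i)%N.

Lemma fifth_root_le n : (fifth_root n ^ 5 <= n)%N.
Proof.
rewrite /fifth_root; elim/big_ind: _ => // i j.
by rewrite /maxn; case: ifP.
Qed.

Lemma fifth_root_max n j : (j ^ 5 <= n)%N -> (j <= fifth_root n)%N.
Proof.
move=> jn; have jn1 : (j < n.+1)%N.
  by rewrite ltnS (leq_trans _ jn) // -[leqLHS]expn1; case: j {jn} => // j;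
    rewrite leq_pexp2l.
exact: (@leq_bigmax_cond _ (fun i : 'I_n.+1 => i ^ 5 <= n)%N (fun i => i : nat)
  (Ordinal jn1)).
Qed.

Lemma fifth_root_gt n : (n < (fifth_root n).+1 ^ 5)%N.
Proof. by rewrite ltnNge; apply/negP => /fifth_root_max; rewrite ltnn. Qed.

Lemma cvg_inv_fifth_root (R : realType) :
  ((fifth_root n)%:R^-1 : R) @[n --> \oo] --> (0 : R).
Proof.
apply/cvgrPdist_lt => e e0.
pose M := (Num.bound e^-1).
have eM : e^-1 < M%:R by apply: archi_boundP; rewrite invr_ge0 ltW.
have M0 : 0 < M%:R :> R by apply: lt_trans eM; rewrite invr_gt0.
near=> n.
have Mn : (M <= fifth_root n)%N.
  by apply: fifth_root_max; near: n; exact: nbhs_infty_ge.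
have mn : M%:R <= (fifth_root n)%:R :> R by rewrite ler_nat.
have m0 := lt_le_trans M0 mn.
rewrite sub0r normrN ger0_norm ?invr_ge0 ?ltW //.
by rewrite -[e]invrK ltf_pV2 ?posrE ?invr_gt0 //; apply: lt_le_trans eM mn.
Unshelve. all: by end_near.
Qed.

Lemma failure_prob_le (R : realType) (q r : R) (n m : nat) :
  0 < q <= 1 -> 0 < r <= 1 -> (0 < m)%N -> (n < m.+1 ^ 5)%N ->
  (1 - r) ^+ m + n%:R * (1 - q) ^+ m + m%:R^-1
    <= ((6 / r) ^+ 6 + 32 * (6 / q) ^+ 6 + 1) / m%:R.
Proof.
move=> q01 r01 m0 nm; have mR : 0 < m%:R :> R by rewrite ltr0n.
rewrite [leRHS]mulrDl [X in _ <= X + _]mulrDl mul1r lerD2r; apply: lerD.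
  apply: le_trans (one_subX_le r01 m0) _; rewrite ler_wpM2l //.
    by rewrite exprn_ge0 // divr_ge0 // ltW //; case/andP: r01.
  rewrite lef_pV2 ?posrE ?exprn_gt0 // -natrX ler_nat.
  by rewrite -[leqLHS]expn1 leq_pexp2l.
(* The constant 32 is 2^5, from m + 1 <= 2 m. *)
have n_le : n%:R <= 32 * m%:R ^+ 5 :> R.
  rewrite -natrX -natrM ler_nat; apply: leq_trans (ltnW nm) _.
  rewrite -[32%N]/(2 ^ 5)%N -expnMn leq_exp2r // mul2n -addnn -addn1.
  by rewrite leq_add2l.
have [q0 q1] := andP q01.
apply: le_trans (_ : 32 * m%:R ^+ 5 * ((6 / q) ^+ 6 / m%:R ^+ 6) <= _).
  by apply: ler_pM; rewrite ?exprn_ge0 ?subr_ge0 ?one_subX_le.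
by rewrite le_eqVlt; apply/orP; left; apply/eqP; field; rewrite !gt_eqF.
Qed.

End Asymptotics.

(** * The construction *)

Section Construction.
Variables (W : finType) (F : sgraph W) (k : nat) (A B : 'I_k -> {set W}).
Hypothesis noiso : no_isolated F.
Hypothesis ABF : component_bipartitions F A B.
Hypothesis leAB : forall i, #|A i| <= #|B i|.

Lemma connect_adj_sym : symmetric (connect (adj F)).
Proof. by apply: sym_connect_sym => x y; rewrite adj_sym. Qed.

(** The unions of [A i] and [B i] list each component exactly once, so every vertex has a single
    index; [comp] then replaces the set of components. *)
Lemma component_labelling : exists comp : W -> 'I_k,
  (forall x i, (x \in A i :|: B i) = (comp x == i)) /\
  (forall x y, (comp x == comp y) = connect (adj F) x y).
Proof.
case: ABF => injAB imAB _.
have eqR : {in [set: W] & &, equivalence_rel (connect (adj F))}.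
  move=> x y z _ _ _; split=> // xy.
  by apply/idP/idP; apply: connect_trans; rewrite // connect_adj_sym.
have /and3P[/eqP cov triv _] := equivalence_partitionP eqR.
rewrite -/(components F) in cov triv.
have comp_ex x : exists i, x \in A i :|: B i.
  have: x \in cover (components F) by rewrite cov inE.
  rewrite -mem_pblock => xx.
  have := pblock_mem (_ : x \in cover (components F)).
  rewrite cov inE -imAB => /(_ isT)/imsetP[i _ Ei]; exists i.
  by rewrite -Ei imAB.
have [comp compP] := fin_all_exists comp_ex.
have compE x i : (x \in A i :|: B i) = (comp x == i).
  apply/idP/eqP => [xi|<-//]; apply: injAB.
  have inC j : A j :|: B j \in components F by rewrite -imAB; apply: imset_f.
  by rewrite -(def_pblock triv (inC _) xi) (def_pblock triv (inC _) (compP x)).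
exists comp; split=> // x y.
rewrite eq_sym -compE.
have inC : A (comp x) :|: B (comp x) \in components F.
  by rewrite -imAB; apply: imset_f.
rewrite -(def_pblock triv inC (compP x)).
by rewrite (pblock_equivalence_partition eqR) ?inE.
Qed.

Variable comp : W -> 'I_k.
Hypothesis compE : forall x i, (x \in A i :|: B i) = (comp x == i).
Hypothesis compC : forall x y, (comp x == comp y) = connect (adj F) x y.

Lemma comp_adj x y : adj F x y -> comp x = comp y.
Proof. by move=> xy; apply/eqP; rewrite compC connect1. Qed.

(** Induction along a path. It shows that an embedding of [F] into a skeleton sends each component
    into one piece. *)
Lemma comp_invariant (T : eqType) (phi : W -> T) :
  (forall x y, adj F x y -> phi x = phi y) ->
  forall x y, comp x = comp y -> phi x = phi y.
Proof.
move=> phi_adj x y /eqP; rewrite compC => /connectP[p].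
elim: p x => [x _ -> //|z p IHp x /= /andP[xz zp] ey].
by rewrite (phi_adj _ _ xz); apply: IHp.
Qed.

Lemma comp_of_A i x : x \in A i -> comp x = i.
Proof. by move=> xA; apply/eqP; rewrite -compE inE xA. Qed.

Lemma comp_of_B i x : x \in B i -> comp x = i.
Proof. by move=> xB; apply/eqP; rewrite -compE inE xB orbT. Qed.

Lemma comp_notA x : (x \in B (comp x)) = (x \notin A (comp x)).
Proof.
case: ABF => _ _ /(_ (comp x)) [_ dAB _ _].
have := compE x (comp x); rewrite eqxx inE.
case: (boolP (x \in A _)) => [xA _|_ /=//].
by apply/negbTE; rewrite (disjointFr dAB).
Qed.

Lemma adj_sides x y : adj F x y -> (x \in A (comp x)) != (y \in A (comp y)).
Proof.
move=> xy; case: ABF => _ _ /(_ (comp x)) [_ _ iA iB].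
rewrite -(comp_adj xy).
have := iA x y; have := iB x y;
  rewrite xy {2}(comp_adj xy) !comp_notA -(comp_adj xy).
by case: (x \in A _); case: (y \in A _) => //= i1 i2;
  [have := i2 isT isT | have := i1 isT isT].
Qed.

(** A component contains an edge, no vertex being isolated, and the ends of an edge lie on opposite
    sides. *)
Lemma side_gt0 i : 0 < #|A i|.
Proof.
case: ABF => _ imAB _; have iF : A i :|: B i \in components F.
  by rewrite -imAB; apply: imset_f.
have [x xi] : exists x, x \in A i :|: B i.
  by have /imsetP[x _ ->] := iF; exists x; rewrite !inE connect0.
have ci : comp x = i by apply/eqP; rewrite -compE.
apply/card_gt0P; case: (boolP (x \in A i)) => [xA|xNA]; first by exists x.
have [y xy] := noiso x; exists y.
have := adj_sides xy; rewrite -(comp_adj xy) ci (negbTE xNA).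
by case: (y \in A i).
Qed.
Variables (a delta : nat) (i0 : 'I_k) (x0 : W).
Hypothesis leAa : forall i, #|A i| <= a.
Hypothesis Ai0 : #|A i0| = a.
Hypothesis x0A : x0 \in A i0.
Hypothesis degx0 : degree F x0 = delta.

(** The components that do not fit in a bipartite piece with fewer than [a] vertices on the left,
    and so compete for the clique. *)
Definition large_part : {set W} := [set x | #|A (comp x)| == a].

(** * Unions of a clique and complete bipartite pieces *)

Section Skeleton.
Variables (V : finType) (K : eqType) (c : V -> option K) (s : V -> bool).

(* Colour None marks the clique; colour Some j marks a complete bipartite graph
   whose two sides are told apart by s. *)
Definition skeleton : rel V :=
  [rel u v | [&& u != v, c u == c v & (c u == None) || (s u != s v)]].

Definition piece_left j : {set V} := [set u | (c u == Some j) && s u].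
Definition piece_right j : {set V} := [set u | (c u == Some j) && ~~ s u].
Definition piece_clique : {set V} := [set u | c u == None].

Lemma skeleton_sym : symmetric skeleton.
Proof.
move=> u v; rewrite /skeleton /= eq_sym (eq_sym (c u)) (eq_sym (s u)).
by case: eqP => //=; case: eqP => // ->.
Qed.

Lemma skeleton_irr : irreflexive skeleton.
Proof. by move=> u; rewrite /skeleton /= eqxx. Qed.

(* A component of F mapped into a bipartite piece has one of its two sides
   inside the piece's left part, which is too small if that side has size a. *)
Lemma skeleton_free (E : {set {set V}}) :
  (forall u v, [set u; v] \in E -> skeleton u v) ->
  (forall j, #|piece_left j| < a) ->
  #|piece_clique| < #|large_part| -> ~~ has_copy F E.
Proof.
move=> sE left_lt clique_lt; apply/has_copyP => -[f [injf fE]].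
have f_adj x y : adj F x y -> skeleton (f x) (f y) by move=> /fE/sE.
have c_inv x y : comp x = comp y -> c (f x) = c (f y).
  apply: (comp_invariant (phi := c \o f)) => {}x {}y /f_adj.
  by case/and3P=> _ /eqP.
(* Off the clique, [phi x] says that the component of [x] is embedded with its [B] side on the left.
   Along an edge of [F] both [s] and membership in [A] flip, so [phi] is constant on components. *)
pose phi x := (c (f x) == None) || (s (f x) (+) (x \in A (comp x))).
have phi_inv x y : comp x = comp y -> phi x = phi y.
  apply: comp_invariant => {}x {}y xy.
  have := adj_sides xy; have := f_adj _ _ xy.
  rewrite /phi => /and3P[_ /eqP-> ]; case: (c (f y) == None) => //=.
  by case: (s _) (s _) (_ \in _) (_ \in _) => [] [] [] [].
have large_None x : x \in large_part -> c (f x) = None.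
  rewrite inE => /eqP Aa; case Ex: (c (f x)) => [j|//]; exfalso.
  have cj y : comp y = comp x -> c (f y) = Some j by move=> /c_inv ->.
  have := left_lt j; rewrite ltnNge => /negP; apply.
  case: (boolP (phi x)) => phix; rewrite -Aa.
    apply: leq_trans (leAB (comp x)) _.
    rewrite -(card_imset _ injf); apply/subset_leq_card/subsetP =>
      _ /imsetP[y yB ->].
    have cy := comp_of_B yB.
    rewrite inE cj // eqxx /=; move: phix; rewrite (phi_inv x y) // /phi cj //=.
    by have := comp_notA y; rewrite cy yB; case: (y \in A _); case: (s _).
  rewrite -(card_imset _ injf); apply/subset_leq_card/subsetP =>
    _ /imsetP[y yA ->].
  have cy := comp_of_A yA.
  rewrite inE cj // eqxx /=; move: phix; rewrite (phi_inv x y) // /phi cj //=.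
  by rewrite cy yA; case: (s _).
move: clique_lt; rewrite ltnNge => /negP; apply.
rewrite -(card_imset _ injf); apply/subset_leq_card/subsetP =>
  _ /imsetP[y yB ->].
by rewrite inE large_None.
Qed.

Variables (H : sgraph V) (gd : 'I_k -> bool -> K) (j : K).
Hypothesis gd_inj : forall i b i' b', gd i b = gd i' b' -> i = i' /\ b = b'.
Hypothesis gd_left : forall i b, a <= #|piece_left (gd i b)|.+1.
Hypothesis gd_right : forall i b, #|W| <= #|piece_right (gd i b)|.
Hypothesis gd_j : forall i b, gd i b != j.
Hypothesis j_left : a <= #|piece_left j|.+1.
Hypothesis j_right : 2 * #|W| < #|piece_right j|.
Hypothesis clique_ge : #|large_part| <= #|piece_clique|.+1.
Hypothesis skH : forall u v, skeleton u v -> adj H u v.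

(** [x0] goes to [v], its neighbours to [delta] neighbours of [v] in the right part of piece [j],
    and the rest of component [i0] into that piece, [v] making up for the missing left vertex. Other
    components with smaller side [a] go to the clique, the remaining ones to the gadgets [gd], all
    avoiding [v]. *)
Lemma skeleton_copy v : v \notin piece_left j ->
  delta <= #|[set u in piece_right j | adj H v u]| -> has_copy F (edges H).
Proof.
move=> vNj le_delta.
have [Y YN cardY] : exists2 Y : {set V},
    Y \subset [set u in piece_right j | adj H v u] & #|Y| = delta.
  pose N := [set u in piece_right j | adj H v u].
  exists [set u in take delta (enum N)].
    by apply/subsetP => u; rewrite inE => /mem_take; rewrite mem_enum.
  rewrite cardsE; have /card_uniqP -> := take_uniq delta (enum_uniq N).
  by rewrite size_take -cardE; case: ltngtP le_delta.
have YP u : u \in Y -> [/\ c u = Some j, s u = false & adj H v u].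
  by move=> /(subsetP YN); rewrite !inE => /andP[/andP[/eqP-> /negbTE->] ->].
have vNY : v \notin Y.
  by apply/negP => /YP[_ _ /adj_neq]; rewrite eqxx.
(* The second gadget is taken exactly when [v] lies in the first. *)
pose g i := gd i (c v == Some (gd i false)).
have cvg i : c v != Some (g i).
  rewrite /g; case: (eqVneq (c v) (Some (gd i false))) => [->|//].
  by apply/eqP => -[/gd_inj[]].
have g_inj i i' : g i = g i' -> i = i' by move=> /gd_inj[].
(* Roles: 3 marks [v], 2 marks [Y], [(None, 0)] the clique, and with a colour [Some] the number is
   the side. As [v] and [Y] are withdrawn from their pieces, the counts below must absorb that
   loss. *)
pose sigma u : option K * nat :=
  if u == v then (None, 3) else if u \in Y then (None, 2)
  else if c u is Some j' then (Some j', nat_of_bool (s u)) else (None, 0).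
pose tau x : option K * nat :=
  if x == x0 then (None, 3) else if adj F x0 x then (None, 2)
  else if comp x == i0 then (Some j, nat_of_bool (x \in A i0))
  else if #|A (comp x)| == a then (None, 0)
  else (Some (g (comp x)), nat_of_bool (x \in A (comp x))).
have compx0 : comp x0 = i0 by apply: comp_of_A x0A.
have sigma_Some u j' (b : bool) : sigma u = (Some j', nat_of_bool b) ->
    c u = Some j' /\ s u = b.
  rewrite /sigma; do 2!case: ifP => // _; case: (c u) => // ? [-> sb].
  by split=> //; move: sb; case: (s u) b => [] [].
have sigma0 u : sigma u = (None, 0) -> c u = None.
  by rewrite /sigma; do 2!case: ifP => // _; case: (c u).
have sigma2 u : sigma u = (None, 2) -> u \in Y.
  by rewrite /sigma; do 2!case: ifP => // _; case: (c u).
have sigma3 u : sigma u = (None, 3) -> u = v.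
  by rewrite /sigma; case: eqP => // _; case: ifP => // _; case: (c u).
have fib x : #|[set y | tau y == tau x]| <= #|[set u | sigma u == tau x]|.
  rewrite {2 3}/tau; case: (eqVneq x x0) => [_|xNx0].
    apply: (@leq_trans #|[set v]|); last first.
      by apply/subset_leq_card; rewrite sub1set inE /sigma eqxx.
    rewrite cards1 -[X in _ <= X](cards1 x0);
      apply/subset_leq_card/subsetP => y.
    by rewrite !inE /tau; do ?case: ifP => //.
  case: (boolP (adj F x0 x)) => [x0x|x0Nx].
    apply: (@leq_trans #|Y|); last first.
      apply/subset_leq_card/subsetP => u uY; rewrite inE /sigma uY.
      by have [uv|] := eqVneq u v; [rewrite -uv uY in vNY | rewrite eqxx].
    rewrite cardY -degx0; apply/subset_leq_card/subsetP => y.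
    by rewrite !inE /tau; do ?case: ifP => //.
  case: (eqVneq (comp x) i0) => [xi0|xNi0].
    case: (boolP (x \in A i0)) => [xA|xNA] /=.
      apply: (@leq_trans #|piece_left j|).
        apply: (@leq_trans #|A i0 :\ x0|); last first.
          by move: j_left; rewrite -Ai0 (cardsD1 x0 (A i0)) x0A.
        apply/subset_leq_card/subsetP => y; rewrite !inE /tau.
        case: (eqVneq y x0) => //= _; case: ifP => // _; case: ifP => _.
          by rewrite xpair_eqE eqxx; case: (y \in A i0).
        case: ifP => // _; rewrite xpair_eqE => /andP[/eqP[gj]].
        by have := gd_j (comp y) (c v == Some (gd (comp y) false));
          rewrite -gj eqxx.
      apply/subset_leq_card/subsetP => u; rewrite !inE => /andP[/eqP cu su].
      rewrite /sigma; case: (eqVneq u v) => [uv|_].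
        by move: vNj; rewrite inE -uv cu eqxx su.
      by case: ifP => [/YP[_]|_]; rewrite ?su // cu.
    (* The right part of piece [j] loses at most [#|W|] vertices to [Y] and one to [v]; having more
       than [2 * #|W|], it keeps at least [#|W|]. *)
    apply: leq_trans (max_card _) _.
    apply: (@leq_trans #|(piece_right j :\: Y) :\ v|).
      have := cardsID Y (piece_right j);
        have := subset_leq_card (subsetIr (piece_right j) Y).
      have dW : delta <= #|W| by rewrite -degx0 max_card.
      rewrite cardY (cardsD1 v (_ :\: _)); move: j_right;
        case: (v \in _ :\: _); lia.
    apply/subset_leq_card/subsetP => u; rewrite !inE =>
      /and3P[uv uY /andP[/eqP cu su]].
    by rewrite /sigma (negbTE uv) (negbTE uY) cu (negbTE su).
  case: (boolP (#|A (comp x)| == a)) => [xa|xNa].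
    apply: (@leq_trans #|large_part :\: (A i0 :|: B i0)|).
      apply/subset_leq_card/subsetP => y; rewrite in_setD compE inE /tau.
      case: (eqVneq y x0) => //= _; case: ifP => // _; case: ifP => // _.
      by case: ifP => // ya; rewrite inE ya.
    apply: (@leq_trans #|piece_clique :\ v|).
      have := cardsID (A i0 :|: B i0) large_part.
      have -> : large_part :&: (A i0 :|: B i0) = A i0 :|: B i0.
        apply/setIidPr/subsetP => y; rewrite compE => /eqP cy.
        by rewrite inE cy Ai0.
      (* Of two vertices of component [i0], one offsets the clique being one short, the other the
         possible loss of [v]. *)
      have : 1 < #|A i0 :|: B i0|.
        have [y x0y] := noiso x0.
        apply/card_gt1P; exists x0, y; split; rewrite ?compE ?compx0 //.
          by rewrite -(comp_adj x0y) compx0.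
        exact: adj_neq x0y.
      move: clique_ge; rewrite (cardsD1 v piece_clique); case: (v \in _); lia.
    apply/subset_leq_card/subsetP => u; rewrite !inE => /andP[uv /eqP cu].
    rewrite /sigma (negbTE uv) cu; case: ifP => // /YP[]; by rewrite cu.
  have gNY u i : c u = Some (g i) -> (u \in Y) = false.
    move=> cu; apply/negP => /YP[]; rewrite cu => -[] gj.
    by have := gd_j i (c v == Some (gd i false)); rewrite -gj eqxx.
  case: (boolP (x \in A (comp x))) => [xA|xNA] /=.
    apply: (@leq_trans #|piece_left (g (comp x))|).
      apply: (@leq_trans #|A (comp x)|); last first.
        have := gd_left (comp x) (c v == Some (gd (comp x) false)).
        rewrite -/(g _); have := leAa (comp x); move: xNa; lia.
      apply/subset_leq_card/subsetP => y; rewrite inE /tau.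
      case: (eqVneq y x0) => //= _; case: ifP => // _; case: ifP => _.
        rewrite xpair_eqE => /andP[/eqP[gj]].
        by have := gd_j (comp x) (c v == Some (gd (comp x) false));
          rewrite -/(g _) -gj eqxx.
      case: ifP => // _; rewrite xpair_eqE => /andP[/eqP[/g_inj->]].
      by case: (y \in A (comp x)).
    apply/subset_leq_card/subsetP => u; rewrite !inE => /andP[/eqP cu su].
    rewrite /sigma (gNY _ _ cu) cu su; case: (eqVneq u v) => // uv.
    by have := cvg (comp x); rewrite -cu uv eqxx.
  apply: leq_trans (max_card _) _.
  apply: leq_trans (gd_right (comp x) (c v == Some (gd (comp x) false))) _.
  apply/subset_leq_card/subsetP => u; rewrite !inE => /andP[/eqP cu su].
  rewrite /sigma (gNY _ _ cu) cu (negbTE su); case: (eqVneq u v) => // uv.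
  by have := cvg (comp x); rewrite -cu uv eqxx.
have [f [injf sf]] := fiber_injection fib.
apply/has_copyP; exists f; split=> //.
(* By symmetry each edge is read from its end in [A]. Edges at [x0] go to edges from [v] to [Y], all
   others to skeleton edges. *)
suff f_adj x y : adj F x y -> x \in A (comp x) -> adj H (f x) (f y).
  move=> x y xy; case: (boolP (x \in A (comp x))) => [/(f_adj _ _ xy) //|xNA].
  have := adj_sides xy; rewrite (negbTE xNA).
  case: (boolP (y \in A _)) => // yA _; rewrite setUC; apply: f_adj => //.
  by rewrite adj_sym.
move=> xy xA; have yNA : y \notin A (comp y).
  by have := adj_sides xy; rewrite xA; case: (y \in _).
have cxy := comp_adj xy.
have yNx0 : y != x0 by apply: contraNneq yNA => ->; rewrite compx0.
have := sf x; have := sf y; rewrite /tau (negbTE yNx0).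
case: (eqVneq x x0) => [xx0|xNx0].
  rewrite -xx0 xy => /sigma2/YP[_ _ ?] /sigma3 -> //.
have -> : adj F x0 x = false.
  apply/negP => /(adj_sides).
  by rewrite xA compx0 x0A.
rewrite -cxy; case: (eqVneq (comp x) i0) => [xi0|xNi0].
  have -> : x \in A i0 by rewrite -xi0.
  have -> : y \in A i0 = false by rewrite -xi0 cxy (negbTE yNA).
  move=> fy /(sigma_Some _ _ true) [cfx sfx]; apply: skH.
  (* Vertices of [Y] still lie in the right part of piece [j], so the skeleton joins them to its
     whole left part. *)
  have [cfy sfy] : c (f y) = Some j /\ s (f y) = false.
    by move: fy; case: ifP => _ => [/sigma2/YP[]|/(sigma_Some _ _ false)].
  rewrite /skeleton /= cfx cfy sfx sfy eqxx andbT.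
  by apply/eqP => e; move: sfx; rewrite e sfy.
have -> : adj F x0 y = false.
  by apply/negP => /(comp_adj) e; move: xNi0; rewrite cxy -e compx0 eqxx.
case: ifP => _.
  move=> /sigma0 cfy /sigma0 cfx; apply: skH.
  rewrite /skeleton /= cfx cfy eqxx andbT (inj_eq injf).
  exact: adj_neq xy.
rewrite xA cxy (negbTE yNA) => /(sigma_Some _ _ false) [cfy sfy].
move=> /(sigma_Some _ _ true) [cfx sfx]; apply: skH.
rewrite /skeleton /= cfx cfy sfx sfy eqxx andbT.
by apply/eqP => e; move: sfx; rewrite e sfy.
Qed.

End Skeleton.

(** * Saturating the skeleton and counting edges *)

Section SaturationBound.
Variables (V : finType) (G : sgraph V) (m : nat) (j0 : 'I_m).
Variables (c : V -> option ('I_m + ('I_k * bool))) (s : V -> bool).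
Hypothesis skG : forall u v, skeleton c s u v -> adj G u v.
Hypothesis cliqueE : #|piece_clique c| = #|large_part|.-1.
Hypothesis leftE : forall j, #|piece_left c s j| = a.-1.
Hypothesis gadgetE : forall g, #|W| <= #|piece_right c s (inr g)|.

(** Colour [inl j] stands for the pair S_j, V_j and [inr g] for a gadget, so this is the union of
    the V_j. *)
Definition bulk : {set V} :=
  [set u | if c u is Some (inl _) then ~~ s u else false].
Definition level (u : V) : 'I_m := if c u is Some (inl j) then j else j0.
Definition outside : {set V} :=
  [set u | if c u is Some (inl _) then false else true].

(** [x] bounds the exceptional vertices: at most [q] in the clique and gadgets, [m] source sets of
    size a - 1, and the right parts too small for [skeleton_copy]. That lemma bounds the degrees
    into the remaining right parts, since a saturated graph is [F]-free. *)
Lemma sat_skeleton_bound (q d x : nat) :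
  #|outside| <= q -> d = delta.-1 -> x = q + m * (a.-1 + 2 * #|W|) ->
  2 * sat F G <= d * #|V| + 2 * (d * \sum_(u in bulk) level u)
                 + 2 * (a.-1 * #|V|) + 2 * (x * (m * d)) + x ^ 2.
Proof.
move=> qle dE xE.
have a_gt0 : 0 < a by rewrite -Ai0; apply/card_gt0P; exists x0.
have delta_gt0 : 0 < delta.
  have [y x0y] := noiso x0.
  by rewrite -degx0 /degree; apply/card_gt0P; exists y; rewrite inE.
have large_gt0 : 0 < #|large_part|.
  by apply/card_gt0P; exists x0; rewrite inE (comp_of_A x0A) Ai0.
have sksym := @skeleton_sym _ _ c s; have skirr := @skeleton_irr _ _ c s.
have [H [skH satH]] : exists H, edges (graph_of (skeleton c s)) \subset edges H
                                /\ saturated F G H.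
  apply: saturated_extension.
    apply/subsetP => e /edge_adj[u [v [-> ]]].
    by rewrite mem_graph_of // => /skG.
  apply: (skeleton_free (c := c) (s := s)).
  - by move=> u v uv; rewrite -mem_graph_of.
  - by move=> j; rewrite leftE prednK.
  - by rewrite cliqueE prednK.
have {}skH u v : skeleton c s u v -> adj H u v.
  by rewrite -(mem_graph_of u v sksym skirr); apply: (subsetP skH).
apply: (@leq_trans (2 * #|edges H|)); first by rewrite leq_mul2l sat_le.
have Hfree : ~~ has_copy F (edges H) by case/and3P: satH.
pose big j := 2 * #|W| < #|piece_right c s (inl j)|.
pose D : {set V} := [set u in bulk | big (level u)].
have D_bulk u : u \in D ->
    [/\ c u = Some (inl (level u)), ~~ s u & big (level u)].
  rewrite !inE /level; case: (c u) => [[j|//]|//] /andP[]; by split.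
pose S j := piece_left c s (inl j).
have := @edge_count V H m a.-1 d D level S.
have DS j v : v \in D -> v \notin S j.
  by move=> /D_bulk[_ /negbTE sv _]; rewrite inE sv andbF.
have Sle j : #|S j| <= a.-1 by rewrite leftE.
move=> /(_ DS Sle) count.
have deg v j : v \notin S j -> #|[set u in D | (level u == j) && adj H v u]| <=
  d.
  move=> vNS; rewrite dE -ltnS prednK //.
  case: (boolP (big j)) => [bj|bj]; last first.
    rewrite eq_card0 // => u; rewrite !inE /level.
    case: (c u) => [[i|//]|//].
    by case: eqP => [->|]; rewrite ?(negbTE bj) ?andbF.
  rewrite ltnNge; apply: contra Hfree => le_delta.
  apply: (skeleton_copy (gd := fun i b => inr (i, b)) (c := c) (s := s) (j :=
    inl j) _ _ _ _ _ _ _ _ vNS) => //.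
  - by move=> i b i' b' [].
  - by move=> i b; rewrite leftE prednK.
  - by rewrite leftE prednK.
  - by rewrite cliqueE prednK.
  - apply: leq_trans le_delta _; apply/subset_leq_card/subsetP => u.
    rewrite !inE; case/and3P => uD /eqP <- uv.
    have [cu su _] : [/\ c u = Some (inl (level u)), ~~ s u & big (level u)].
      by apply: D_bulk; rewrite !inE.
    by rewrite cu eqxx su.
have {count} count := count deg.
have DC : #|~: D| <= x.
  have sub : ~: D \subset outside :|: \bigcup_j S j
               :|: \bigcup_(j | ~~ big j) piece_right c s (inl j).
    apply/subsetP => u; rewrite !inE /level; case cu: (c u) => [[j|//]|//] /=.
    case: (boolP (s u)) => su /= bj.
      apply/orP; left; apply/bigcupP; exists j => //.
      by rewrite inE cu su eqxx.
    apply/orP; right; apply/bigcupP; exists j => //.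
    by rewrite inE cu su eqxx.
  apply: leq_trans (subset_leq_card sub) _.
  rewrite xE mulnDr addnA.
  apply: leq_trans (leq_card_setU _ _) _; apply: leq_add.
    apply: leq_trans (leq_card_setU _ _) _; apply: leq_add => //.
    apply: leq_trans (card_bigcup_le _ _) _.
    by under eq_bigr do rewrite leftE; rewrite sum_nat_const card_ord.
  apply: leq_trans (card_bigcup_le _ _) _.
  apply: (@leq_trans (\sum_(j | ~~ big j) 2 * #|W|)).
    by apply: leq_sum => j; rewrite -leqNgt.
  rewrite sum_nat_const leq_mul2r; apply/orP; right.
  by rewrite -[leqRHS](card_ord m) max_card.
have Dsum : \sum_(v in D) level v <= \sum_(v in bulk) level v.
  rewrite [leqLHS]big_mkcond [leqRHS]big_mkcond; apply: leq_sum => v _.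
  by rewrite inE; case: (v \in bulk) => //=; case: (big _).
apply: leq_trans count _.
apply: leq_add; last by rewrite leq_exp2r.
apply: leq_add; last by rewrite leq_mul2l /= leq_mul2r DC orbT.
by rewrite leq_add2r leq_add2l leq_mul2l /= leq_mul2l Dsum orbT.
Qed.

End SaturationBound.

(* Each component gets two bipartite gadgets, so that one of them avoids any
   given vertex. *)
Notation N := (#|large_part|.-1).
Notation block_site := ('I_N + ('I_k * bool) * ('I_a.-1 + W))%type.
(** The source sets and [m] candidate blocks get disjoint places; the gadget will occupy a block
    that is a clique of the random graph. *)
Notation site m := ('I_m * 'I_a.-1 + 'I_m * block_site)%type.

(** * Placing the skeleton in the random graph *)

Section Layout.
Variables (n m : nat) (j0 : 'I_m) (place : site m -> 'I_n).
Hypothesis place_inj : injective place.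

Definition sources : {set 'I_n} := [set place (inl ix) | ix : 'I_m * 'I_a.-1].
Definition star (v : 'I_n) (i : 'I_m) : {set {set 'I_n}} :=
  [set [set v; place (inl (i, x))] | x : 'I_a.-1].
Definition block (b : 'I_m) : {set 'I_n} := [set place (inr (b, y)) | y :
  block_site].
Definition block_pairs (b : 'I_m) : {set {set 'I_n}} :=
  [set e : {set 'I_n} | e \subset block b & #|e| == 2].

Lemma card_star v i : v \notin sources -> #|star v i| = a.-1.
Proof.
move=> vS; rewrite card_imset ?card_ord // =>
  x y /setP/(_ (place (inl (i, x)))).
rewrite !inE eqxx orbT => /esym/orP[/eqP e|/eqP/place_inj[] //].
by case/imsetP: vS; exists (i, x); rewrite // e.
Qed.

Lemma star_pairs v i : v \notin sources -> star v i \subset vertex_pairs 'I_n.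
Proof.
move=> vS; apply/subsetP => _ /imsetP[x _ ->]; rewrite inE cards2.
suff -> : v != place (inl (i, x)) by [].
by apply: contraNneq vS => ->; apply/imsetP; exists (i, x).
Qed.

(** An edge of a star has exactly one end among the sources, hence determines both the vertex and
    the index. This is the source of independence. *)
Lemma star_disjoint u v i j : u \notin sources -> v \notin sources ->
  (u, i) != (v, j) -> [disjoint star u i & star v j].
Proof.
move=> uS vS; apply: contraR => /pred0Pn[e /andP[/imsetP[x _ ex] /imsetP[y _]]].
have nS z l w : z \notin sources -> z = place (inl (l, w)) -> False.
  by move=> zS ez; case/imsetP: zS; exists (l, w).
rewrite ex => exy.
have : place (inl (i, x)) \in [set v;
  place (inl (j, y))] by rewrite -exy !inE eqxx orbT.
have : u \in [set v; place (inl (j, y))] by rewrite -exy !inE eqxx.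
rewrite !inE => /orP[/eqP<-|/eqP/(nS _ _ _ uS) //].
by case/orP=> [/eqP/esym/(nS _ _ _ uS) //|/eqP/place_inj[-> _]].
Qed.

Lemma card_block b : #|block b| = #|{: block_site}|.
Proof. by rewrite card_imset // => y z /place_inj[]. Qed.

Lemma card_block_pairs b : #|block_pairs b| = 'C(#|{: block_site}|, 2).
Proof. by rewrite cards_draws card_block. Qed.

Lemma block_pairs_disjoint b b' : b != b' ->
  [disjoint block_pairs b & block_pairs b'].
Proof.
apply: contraR => /pred0Pn[e /andP[]]; rewrite !inE =>
  /andP[/subsetP eb e2] /andP[/subsetP eb' _].
have /card_gt0P[u ue] : 0 < #|e| by rewrite (eqP e2).
have /imsetP[y _ uy] := eb u ue; have /imsetP[y' _] := eb' u ue.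
by rewrite uy => /place_inj[-> _].
Qed.

Section Colouring.
Variables (G : sgraph 'I_n) (b : 'I_m) (lv : 'I_n -> 'I_m).
Hypothesis block_clique : block_pairs b \subset edges G.
Hypothesis star_lv : forall v, v \notin sources -> star v (lv v) \subset edges
  G.

Definition site_of (u : 'I_n) : option (site m) := [pick t | place t == u].

(** Only block [b] carries the gadget; vertices of the other blocks are ordinary and join the class
    of their level. *)
Definition colour (u : 'I_n) : option ('I_m + ('I_k * bool)) :=
  match site_of u with
  | Some (inl (i, _)) => Some (inl i)
  | Some (inr (b', y)) =>
      if b' == b then if y is inr (g, _) then Some (inr g) else None
      else Some (inl (lv u))
  | None => Some (inl (lv u))
  end.

Definition source_side (u : 'I_n) : bool :=
  match site_of u with
  | Some (inl _) => true
  | Some (inr (b', y)) =>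
    (b' == b) && (if y is inr (_, inl _) then true else false)
  | None => false
  end.

Lemma site_of_place t : site_of (place t) = Some t.
Proof.
rewrite /site_of; case: pickP => [t' /eqP/place_inj->//|/(_ t)].
by rewrite eqxx.
Qed.

Lemma site_ofK u t : site_of u = Some t -> u = place t.
Proof. by rewrite /site_of; case: pickP => // t' /eqP <- [->]. Qed.

Variant vertex_spec (u : 'I_n) :
    option ('I_m + ('I_k * bool)) -> bool -> Prop :=
  | SourceVertex i x of u = place (inl (i, x)) : vertex_spec u (Some (inl i))
    true
  | CliqueVertex z of u = place (inr (b, inl z)) : vertex_spec u None false
  | LeftVertex g x of u = place (inr (b, inr (g, inl x))) :
      vertex_spec u (Some (inr g)) true
  | RightVertex g w of u = place (inr (b, inr (g, inr w))) :
      vertex_spec u (Some (inr g)) false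
  | BulkVertex of u \notin sources : vertex_spec u (Some (inl (lv u))) false.

Lemma vertexP u : vertex_spec u (colour u) (source_side u).
Proof.
rewrite /colour /source_side; case Eu: (site_of u) => [[[i x]|[b' y]]|].
- exact: SourceVertex (site_ofK Eu).
- have uy := site_ofK Eu.
  case: eqP => [eb|_]; last first.
    apply: BulkVertex; apply/imsetP => -[[i x] _]; rewrite uy => /place_inj //.
  rewrite eb in uy; case: y uy {Eu} => [z|[g [x|w]]] uy /=.
  + exact: CliqueVertex uy.
  + exact: LeftVertex uy.
  + exact: RightVertex uy.
- apply: BulkVertex; apply/imsetP => -[t _ ut].
  by rewrite ut site_of_place in Eu.
Qed.

(** Edges of the clique and gadgets lie inside block [b], a clique of [G]; every other edge belongs
    to the star of a vertex at its level. *)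
Lemma skeleton_subgraph u v : skeleton colour source_side u v -> adj G u v.
Proof.
have block_adj y z : place (inr (b, y)) != place (inr (b, z)) ->
    adj G (place (inr (b, y))) (place (inr (b, z))).
  move=> yz; apply: (subsetP block_clique); rewrite inE cards2 yz andbT.
  by rewrite subUset !sub1set !imset_f.
have star_adj w x : w \notin sources -> adj G w (place (inl (lv w, x))).
  by move=> wS; apply: (subsetP (star_lv wS)); apply: imset_f.
rewrite /skeleton /= => /and3P[].
case: (vertexP u) => [i x eu|z eu|g x eu|g w eu|uS];
  case: (vertexP v) => [i' x' ev|z' ev|g' x' ev|g' w' ev|vS] //=.
all: try by rewrite eu ev => ? _ _; apply: block_adj.
- by move=> _ /eqP[ei] _; rewrite eu ei adj_sym star_adj.
- by move=> _ /eqP[ei] _; rewrite ev -ei star_adj.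
Qed.

Lemma card_piece_clique : #|piece_clique colour| = N.
Proof.
rewrite -[RHS]card_ord -(card_imset _ (_ : injective (fun z => place (inr (b,
  inl z))))).
  apply: eq_card => u; rewrite inE; apply/idP/imsetP => [|[z _ ->]].
    by case: (vertexP u) => // z -> _; exists z.
  by rewrite /colour site_of_place eqxx.
by move=> z z' /place_inj[].
Qed.

Lemma card_piece_left j : #|piece_left colour source_side j| = a.-1.
Proof.
pose f x := if j is inr g then place (inr (b, inr (g, inl x)))
            else if j is inl i then place (inl (i, x)) else place (inl (j0, x)).
have f_inj : injective f by rewrite /f; case: (j) => ? x y /place_inj[].
rewrite -[RHS]card_ord -(card_imset _ f_inj); apply: eq_card => u.
rewrite inE; apply/idP/imsetP => [|[x _ ->]]; last first.
  by rewrite /f /colour /source_side; case: (j) => ?;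
    rewrite site_of_place ?eqxx.
by case: (vertexP u) => [i x eu|z eu|g x eu|g w eu|uS]; rewrite ?andbF // =>
  /andP[/eqP[ej] _]; exists x; rewrite // /f -ej.
Qed.

Lemma card_piece_right g : #|W| <= #|piece_right colour source_side (inr g)|.
Proof.
rewrite -(card_imset _ (_ : injective (fun w => place (inr (b, inr (g, inr
  w)))))).
  apply/subset_leq_card/subsetP => _ /imsetP[w _ ->].
  by rewrite inE /colour /source_side site_of_place !eqxx.
by move=> w w' /place_inj[].
Qed.

Lemma card_outside : #|outside colour| <= #|{: block_site}|.
Proof.
rewrite -(card_block b); apply/subset_leq_card/subsetP => u; rewrite inE.
by case: (vertexP u) => // [z|g x|g w] -> _; apply: imset_f.
Qed.

(** No index below [lv v] is a hit, so the first hit is at [lv v] or later. *)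
Lemma bulk_level_le (R : realType) :
  (forall v (i : 'I_m), v \notin sources -> i < lv v -> ~~ (star v i \subset
    edges G)) ->
  ((\sum_(u in bulk colour source_side) level j0 colour u)%:R
    <= \sum_(u in ~: sources) first_hit R star u (edges G))%R.
Proof.
move=> lv_min; rewrite natr_sum.
apply: (@le_trans _ _ (\sum_(u in ~: sources) (lv u)%:R)%R).
  rewrite [leLHS]big_mkcond [leRHS]big_mkcond; apply: ler_sum => u _.
  rewrite !inE /level; case: (vertexP u) => [i x|z|g x|g w|->] //= *;
  by case: ifP; rewrite ?ler0n.
apply: ler_sum => u; rewrite inE => uS; apply: first_hit_ge => [|i il].
  exact/ltnW.
exact: lv_min.
Qed.

End Colouring.

End Layout.

(** * Probability of the bound for given n and m *)

Section RandomBound.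
Local Open Scope ring_scope.
Variables (R : realType) (p : R).
Hypothesis p01 : 0 < p < 1.

(** [q] is the probability that a source set is complete to a given vertex, [r] that a block is a
    clique; [x1 * m] bounds the number of exceptional vertices, and [c1 / m] collects the error
    terms. *)
Let K : nat := #|{: block_site}|.
Let d : nat := delta.-1.
Let q : R := p ^+ a.-1.
Let r : R := p ^+ 'C(K, 2).
Let x1 : nat := (K + (a.-1 + 2 * #|W|))%N.
Let c1 : nat := (d + 2 * (x1 * d) + x1 ^ 2)%N.

(** Per vertex, the main terms are d / 2 inside a level, d (1 / q - 1) towards earlier levels, and a
    - 1 towards the sources. *)
Lemma sat_real_bound (n m s L : nat) :
  (0 < m)%N -> (m ^ 5 <= n)%N ->
  (2 * s <= d * n + 2 * (d * L) + 2 * (a.-1 * n)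
      + 2 * ((K + m * (a.-1 + 2 * #|W|)) * (m * d))
      + (K + m * (a.-1 + 2 * #|W|)) ^ 2)%N ->
  L%:R <= n%:R * (q^-1 - 1) + n%:R / m%:R :> R ->
  s%:R <= (d%:R / q - d%:R / 2 + a.-1%:R + c1%:R / m%:R) * n%:R.
Proof.
move=> m0 mn sle Lle; have mR : 0 < m%:R :> R by rewrite ltr0n.
have x_le : (K + m * (a.-1 + 2 * #|W|) <= x1 * m)%N by rewrite /x1; nia.
(* Since m^3 <= m^5 <= n, errors of order m^2 are at most of order n / m. *)
have m2 : m%:R ^+ 2 <= n%:R / m%:R :> R.
  rewrite ler_pdivlMr // -exprSr -natrX ler_nat; apply: leq_trans mn.
  by rewrite leq_pexp2l.
have {sle} : (2 * s <= d * n + 2 * (d * L) + 2 * (a.-1 * n)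
                        + (2 * (x1 * d) + x1 ^ 2) * m ^ 2)%N.
  apply: leq_trans sle _; move: x_le; set x := (K + _)%N => x_le.
  rewrite -addnA leq_add2l mulnDl; apply: leq_add.
    by rewrite -!mulnA leq_mul2l /= [leqRHS]mulnCA [leqRHS](_ : _ = x1 * m * (m
      * d))%N ?leq_mul2r ?x_le ?orbT //; nia.
  by rewrite -expnMn leq_exp2r.
rewrite -(ler_nat R) => sle; rewrite -!mulnn !natrD !natrM in sle.
have d0 : 0 <= d%:R :> R by rewrite ler0n.
have := ler_wpM2l d0 Lle => dL.
have c0 : 0 <= 2 * (x1%:R * d%:R) + x1%:R ^+ 2 :> R.
  by rewrite addr_ge0 ?sqr_ge0 ?mulr_ge0.
have := ler_wpM2l c0 m2 => cm.
have -> : c1%:R = d%:R + 2 * (x1%:R * d%:R) + x1%:R * x1%:R :> R.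
  by rewrite -!natrM -!natrD mulnn.
rewrite -(@ler_pM2l _ 2) //.
have -> : 2 * ((d%:R / q - d%:R / 2 + a.-1%:R
      + (d%:R + 2 * (x1%:R * d%:R) + x1%:R * x1%:R) / m%:R) * n%:R) =
    d%:R * n%:R + 2 * (d%:R * (n%:R * (q^-1 - 1) + n%:R / m%:R)) + 2 * (a.-1%:R
      * n%:R)
    + 2 * ((2 * (x1%:R * d%:R) + x1%:R ^+ 2) * (n%:R / m%:R)) :> R.
  have q0 : q != 0 by rewrite expf_neq0 // gt_eqF //; case/andP: p01.
  by field; rewrite q0 gt_eqF.
have := mulr_ge0 c0 (le_trans (sqr_ge0 _) m2); lra.
Qed.

Lemma Gnp_sat_bound (n m : nat) :
  (0 < m)%N -> (K + a.-1 <= m)%N -> (m ^ 5 <= n)%N ->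
  1 - ((1 - r) ^+ m + n%:R * (1 - q) ^+ m + m%:R^-1) <=
  Gnp_prob p (fun G : sgraph 'I_n =>
    (sat F G)%:R <= (d%:R / q - d%:R / 2 + a.-1%:R + c1%:R / m%:R) * n%:R).
Proof.
move=> m0 mK mn; have mR : 0 < m%:R :> R by rewrite ltr0n.
have n0 : (0 < n)%N by apply: leq_trans mn; rewrite expn_gt0 m0.
have nR : 0 < n%:R :> R by rewrite ltr0n.
have [p0 p1] := andP p01.
pose j0 := Ordinal m0.
have site_le : (#|{: site m}| <= n)%N.
  rewrite card_sum !card_prod !card_ord -/K -mulnDr; apply: leq_trans mn.
  rewrite addnC (leq_trans (leq_mul (leqnn m) mK)) // mulnn leq_pexp2l //.
have [place place_inj] : exists place : site m -> 'I_n, injective place.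
  exists (fun t => widen_ord site_le (enum_rank t)) => t t' /(congr1 val) /= e.
  exact/enum_rank_inj/val_inj.
pose t : R := n%:R / m%:R.
have t0 : 0 < t by rewrite divr_gt0.
pose bad := badness (~: sources place) (star place) q (block_pairs place) t.
have q01 : 0 < q <= 1 by rewrite exprn_gt0 // exprn_ile1 ?ltW.
have prob_pairs (E : {set {set 'I_n}}) l : E \subset vertex_pairs 'I_n ->
    #|E| = l -> \prod_(e in E) edge_prob p e = p ^+ l.
  move=> /subsetP EP <-; rewrite -prodr_const; apply: eq_bigr => e eE.
  by rewrite /edge_prob EP.
have disjA : {in ~: sources place &, forall u v i j, (u, i) != (v, j) ->
    [disjoint star place u i & star place v j]}.
  by move=> u v; rewrite !inE => uS vS i j; apply: star_disjoint.
have probA : {in ~: sources place, forall v i,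
    \prod_(e in star place v i) edge_prob p e = q}.
  move=> v; rewrite inE => vS i; apply: prob_pairs; first exact: star_pairs.
  exact: card_star.
have disjZ := block_pairs_disjoint place_inj.
have probZ b : \prod_(e in block_pairs place b) edge_prob p e = r.
  apply: prob_pairs; last exact: card_block_pairs.
  by apply/subsetP => e; rewrite !inE => /andP[].
have U_le : #|~: sources place|%:R <= n%:R :> R.
  by rewrite ler_nat -[leqRHS](card_ord n) max_card.
have bad_le : expect (@edge_prob R p n) bad <=
    (1 - r) ^+ m + n%:R * (1 - q) ^+ m + m%:R^-1.
  have := expect_badness_le (edge_prob01 p01) q01 disjA probA t0 disjZ probZ.
  move=> /le_trans; apply; apply: lerD; first apply: lerD => //.
    by rewrite ler_wpM2r // exprn_ge0 // subr_ge0; case/andP: q01.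
  (* With t = n / m the Chebyshev term is m^4 / n, at most 1 / m. *)
  apply: (@le_trans _ _ (n%:R * m%:R ^+ 2 / t ^+ 2)).
    by rewrite ler_wpM2r ?invr_ge0 ?sqr_ge0 // ler_wpM2r ?sqr_ge0.
  have -> : n%:R * m%:R ^+ 2 / t ^+ 2 = m%:R ^+ 4 / n%:R.
    by rewrite /t; field; rewrite !gt_eqF.
  by rewrite ler_pdivrMr // ler_pdivlMl // -exprS -natrX ler_nat.
apply: le_trans (Gnp_prob_ge p01 (f := bad) _ _); first by rewrite lerD2l lerN2.
  move=> G; rewrite /bad /badness !addr_ge0 ?divr_ge0 ?sqr_ge0 //.
    by apply: prodr_ge0.
  by apply: sumr_ge0 => v _; apply: prodr_ge0 => i _;
    case/andP: (missed01 R (star place) v i (edges G)).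
move=> G /(badness_lt1 t0)[[b Zb] hitA sum_le].
(* The level of a vertex is the least index of a star present in [G]; sources get the default
   [j0]. *)
have first_ex v : exists i : 'I_m, v \notin sources place ->
    star place v i \subset edges G /\
    forall i' : 'I_m, (i' < i)%N -> ~~ (star place v i' \subset edges G).
  case: (boolP (v \in sources place)) => [_|vS]; first by exists j0.
  have [|i1 Ai1] := hitA v; first by rewrite inE.
  case: (@arg_minnP _ i1 (fun i => star place v i \subset edges G) (fun i => i
    : nat) Ai1) => i Ai imin; exists i => _.
  split=> // i' i'i; apply/negP => /imin.
  by rewrite leqNgt i'i.
have [lv lvP] := fin_all_exists first_ex.
pose c := colour place b lv; pose s := source_side place b.
apply: (@sat_real_bound n m (sat F G) (\sum_(u in bulk c s) level j0 c u)) =>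
  //.
  have := @sat_skeleton_bound 'I_n G m j0 c s.
  rewrite card_ord => bound; apply: (bound _ _ _ _ K) => //.
  - by move=> u v; apply: skeleton_subgraph => // w /lvP[].
  - exact: card_piece_clique.
  - by move=> j; apply: (card_piece_left j0 place_inj).
  - by move=> g; apply: card_piece_right.
  - exact: card_outside.
apply: (le_trans (@bulk_level_le n m j0 place place_inj G b lv R _)) => /=.
  by move=> v i /lvP[_]; apply.
apply: le_trans sum_le _; rewrite lerD2r.
have mu0 : 0 <= first_hit_mean m q.
  by case/andP: (first_hit_mean_itv m q01).
apply: (@le_trans _ _ (n%:R * first_hit_mean m q)); first by rewrite ler_wpM2r.
rewrite ler_wpM2l //; apply: le_trans (geometric_sum_le _ _) _;
  last by rewrite subKr.
by case/andP: q01 => q0 q1; rewrite subr_ge0 q1 gtrBl q0.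
Qed.

End RandomBound.

End Construction.

(** * Letting n tend to infinity *)

Local Open Scope classical_set_scope.
Local Open Scope ring_scope.

Theorem theorem1p1 (R : realType) (p : R) (W : finType) (F : sgraph W)
    (k : nat) (A B : 'I_k -> {set W}) (a delta : nat) :
  0 < p < 1 ->
  (0 < #|W|)%N ->
  bipartite F ->
  no_isolated F ->
  component_bipartitions F A B ->
  (forall i, (#|A i| <= #|B i|)%N) ->
  a = (\max_(i < k) #|A i|)%N ->
  delta = min_degree F (\bigcup_(i < k | #|A i| == a) A i)%SET ->
  exists eps : nat -> R,
    eps @ \oo --> (0 : R) /\
    whp p (fun n (G : sgraph 'I_n) =>
      (sat F G)%:R <=
        ((delta%:R - 1) / p ^+ (a - 1) - (delta%:R - 2 * a%:R + 1) / 2 + eps n)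
        * n%:R).
Proof.
move=> p01 W0 _ noiso ABF leAB aE deltaE.
have [comp [compE compC]] := component_labelling ABF.
have [w _] := card_gt0P W0.
have k0 : (0 < #|'I_k|)%N by apply/card_gt0P; exists (comp w).
have [i1 Ai1] := @bigop.eq_bigmax 'I_k (fun i => #|A i|) k0.
have leAa i : (#|A i| <= a)%N by rewrite aE;
  exact: (@bigop.leq_bigmax 'I_k (fun i => #|A i|) i).
rewrite -aE in Ai1.
have /card_gt0P[x1 x1A] := side_gt0 noiso ABF compE compC i1.
have [x0 /bigcupP[i0 /eqP Ai0 x0A] degx0] :
    exists2 x, x \in (\bigcup_(i < k | #|A i| == a) A i)%SET & degree F x =
      delta.
  rewrite deltaE; apply: (@min_degree_attained _ _ _ x1).
  by apply/bigcupP; exists i1; rewrite // -Ai1.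
have a0 : (0 < a)%N by rewrite -Ai0; apply/card_gt0P; exists x0.
have delta0 : (0 < delta)%N.
  have [y x0y] := noiso x0.
  by rewrite -degx0; apply/card_gt0P; exists y; rewrite inE.
have := Gnp_sat_bound noiso ABF leAB compE compC leAa Ai0 x0A degx0 p01.
set K := #|{: 'I__ + _}|; set x := (K + _)%N;
  set c1 := (delta.-1 + _ + _)%N => sat_bound.
have [p0 p1] := andP p01.
pose q : R := p ^+ a.-1; pose r : R := p ^+ 'C(K, 2).
have q01 : 0 < q <= 1 by rewrite exprn_gt0 // exprn_ile1 ?ltW.
have r01 : 0 < r <= 1 by rewrite exprn_gt0 // exprn_ile1 ?ltW.
pose c2 : R := (6 / r) ^+ 6 + 32 * (6 / q) ^+ 6 + 1.
have cvg_inv := @cvg_inv_fifth_root R.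
exists (fun n => c1%:R * (fifth_root n)%:R^-1); split.
  rewrite -(mulr0 c1%:R); exact: cvgMr.
(* With m the fifth root, the probability lies between 1 - c2 / m and 1. *)
apply: (squeeze_cvgr (f := fun n => 1 - c2 * (fifth_root n)%:R^-1) (h := fun=>
  1)).
- near=> n; rewrite Gnp_prob_le1 // andbT.
  have m0 : (0 < fifth_root n)%N.
    by apply: fifth_root_max; near: n; exact: nbhs_infty_ge.
  have mK : (K + a.-1 <= fifth_root n)%N.
    by apply: fifth_root_max; near: n; exact: nbhs_infty_ge.
  (* With d = delta - 1, the term (delta - 2 a + 1) / 2 equals d / 2 - (a - 1). *)
  have -> : (delta%:R - 1) / p ^+ (a - 1) - (delta%:R - 2 * a%:R + 1) / 2 =
      delta.-1%:R / q - delta.-1%:R / 2 + a.-1%:R :> R.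
    rewrite -[in LHS](prednK delta0) -[in X in 2 * X](prednK a0) subn1 -/q
      -!natr1.
    by field; rewrite gt_eqF //; case/andP: q01.
  apply: le_trans (sat_bound n _ m0 mK (fifth_root_le n)).
  by rewrite lerD2l lerN2 failure_prob_le ?fifth_root_gt.
- rewrite -[X in _ --> X]subr0 -(mulr0 c2).
  by apply: cvgB; [exact: cvg_cst | exact: cvgMr].
- exact: cvg_cst.
Unshelve. all: by end_near.
Qed.
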